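(* Let $K$ be an infinite field (of arbitrary characteristic), let $S=K[x_1,\ldots,x_n]$, let $\Delta$ be a stable simplicial complex on $[n]$, and let $\Delta^e$ be the exterior algebraic shifted complex of $\Delta$. Then for all $i$ and $j$, $$\beta_{i,j}(I_\Delta)=\beta_{i,j}(I_{\Delta^e}).$$
   Context: $[n]=\{1,\ldots,n\}$. A simplicial complex $\Delta$ on $[n]$ is a set of subsets of $[n]$, closed under taking subsets, with $\{i\}\in\Delta$ for all $i\in[n]$. Put $\nabla=\{\sigma\subseteq[n]:\sigma\notin\Delta\}$. For $\sigma\subseteq[n]$ let $x_\sigma=\prod_{i\in\sigma}x_i$. The Stanley-Reisner ideal $I_\Delta\subseteq S$ is generated by all $x_\sigma$ with $\sigma\in\nabla$. For a graded ideal $I$ of $S$, $\beta_{i,j}(I)$ is the graded Betti number: the minimal graded free $S$-resolution of $I$ has $i$-th term $\bigoplus_j S(-j)^{\beta_{i,j}(I)}$. For a monomial $u\ne1$, $m(u)=\max\{i:x_i\mid u\}$. A monomial ideal of $S$ generated by squarefree monomials is squarefree stable if for every squarefree monomial $u\neq 1$ in it and every $i<m(u)$ with $x_i\nmid u$, the monomial $x_i(u/x_{m(u)})$ is in it. $\Delta$ is stable if $I_\Delta$ is squarefree stable. Let $V$ be a $K$-vector space with basis $e_1,\ldots,e_n$ and $E=\bigwedge(V)$ its exterior algebra; for $\sigma=\{i_1<\cdots<i_r\}$ put $e_\sigma=e_{i_1}\wedge\cdots\wedge e_{i_r}$. Let $J_\Delta\subseteq E$ be the ideal generated by all $e_\sigma$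 with $\sigma\in\nabla$. For a graded ideal $J\subseteq E$, $\mathrm{Gin}(J)$ is the generic initial ideal: the common value of $\mathrm{in}(gJ)$ for $g$ in a nonempty Zariski open subset of $\mathrm{GL}_n(K)$ (acting on $V$ and hence on $E$), with respect to the reverse lexicographic order on the monomials $e_\sigma$ induced by $e_1>\cdots>e_n$. $\Delta^e$ is the simplicial complex on $[n]$ defined by $J_{\Delta^e}=\mathrm{Gin}(J_\Delta)$. *)

(* Defs.v *)
From HB Require Import structures.
From mathcomp Require Import all_boot all_order all_algebra all_field.
From mathcomp Require Import mpoly.
From Stdlib Require Import ClassicalEpsilon.

Set Implicit Arguments.
Unset Strict Implicit.
Unset Printing Implicit Defensive.

Import GRing.Theory.
Local Open Scope ring_scope.

Definition infinite_field (K : fieldType) : Prop :=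
  forall s : seq K, exists x : K, x \notin s.

(* Ideals are two-sided; this serves both for polynomial rings and for exterior
   algebras. *)
Definition is_ideal (R : nzRingType) (I : R -> Prop) : Prop :=
  [/\ I 0, (forall a b, I a -> I b -> I (a + b))
    & forall r a, I a -> I (r * a) /\ I (a * r)].

Definition ideal_gen (R : nzRingType) (X : R -> Prop) (a : R) : Prop :=
  forall I : R -> Prop, is_ideal I -> (forall b, X b -> I b) -> I a.

(* The vertex set [n] = {1, ..., n} is rendered as 'I_n = {0, ..., n - 1}. *)
Definition simplicial_complex n (D : {set {set 'I_n}}) : Prop :=
  (forall s t : {set 'I_n}, s \in D -> t \subset s -> t \in D) /\
  (forall i : 'I_n, [set i] \in D).

Definition xprod (K : fieldType) n (s : {set 'I_n}) : {mpoly K[n]} :=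
  \prod_(i in s) 'X_i.

Definition SR_ideal (K : fieldType) n (D : {set {set 'I_n}}) :
    {mpoly K[n]} -> Prop :=
  ideal_gen (fun p => exists2 s : {set 'I_n}, s \notin D & p = xprod K s).
Arguments SR_ideal K {n} D _.

(* The squarefree monomials u <> 1 are the xprod s with s <> set0; for such a
   u, m(u) is the greatest element m of s, and u / x_(m(u)) is xprod (s :\ m). *)
Definition squarefree_stable (K : fieldType) n (I : {mpoly K[n]} -> Prop) :
    Prop :=
  (exists G : {set {set 'I_n}}, forall p,
     I p <-> ideal_gen (fun q => exists2 s, s \in G & q = xprod K s) p) /\
  (forall (s : {set 'I_n}) (m i : 'I_n),
     I (xprod K s) ->
     m \in s -> (forall k, k \in s -> (k <= m)%N) ->
     (i < m)%N -> i \notin s ->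
     I ('X_i * xprod K (s :\ m))).

Definition stable_complex (K : fieldType) n (D : {set {set 'I_n}}) : Prop :=
  squarefree_stable (SR_ideal K D).

(* A complex ... -> F_1 -> F_0 -> S of finitely generated graded free modules
   over S = K[x_1, ..., x_n].  F_i is the direct sum over a < frank i of the
   S(- fdeg i a); its elements are row vectors, and maps act on the right. *)
Record free_complex (K : fieldType) n := FreeComplex {
  frank : nat -> nat;
  fdeg : forall i, 'I_(frank i) -> nat;
  fdiff : forall i, 'M[{mpoly K[n]}]_(frank i.+1, frank i);
  faug : 'cV[{mpoly K[n]}]_(frank 0)
}.

(* Entry of the matrix of a degree-preserving map S(-a) -> S(-b). *)
Definition entry_of_degree (K : fieldType) n (a b : nat) (p : {mpoly K[n]}) :
    Prop :=
  if (b <= a)%N then p \is (a - b).-homog else p == 0.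

Definition graded_complex (K : fieldType) n (F : free_complex K n) : Prop :=
  (forall a, entry_of_degree (fdeg a) 0 (faug F a 0)) /\
  (forall i a b, entry_of_degree (fdeg a) (fdeg b) (fdiff F i a b)).

Definition resolves (K : fieldType) n (F : free_complex K n)
    (I : {mpoly K[n]} -> Prop) : Prop :=
  [/\ (forall p, I p <-> exists v : 'rV_(frank F 0), p = (v *m faug F) 0 0),
      (forall v : 'rV_(frank F 0),
         v *m faug F = 0 <-> exists w, v = w *m fdiff F 0)
    & forall i (v : 'rV_(frank F i.+1)),
        v *m fdiff F i = 0 <-> exists w, v = w *m fdiff F i.+1].

Definition minimal_complex (K : fieldType) n (F : free_complex K n) : Prop :=
  forall i a b,
    ideal_gen (fun p => exists k : 'I_n, p = 'X_k) (fdiff F i a b).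

Definition minimal_graded_free_resolution (K : fieldType) n
    (I : {mpoly K[n]} -> Prop) (F : free_complex K n) : Prop :=
  [/\ graded_complex F, resolves F I & minimal_complex F].

Definition zero_complex (K : fieldType) n : free_complex K n :=
  @FreeComplex K n (fun=> 0%N) (fun _ _ => 0%N) (fun=> 0) 0.

(* Minimal graded free resolutions of a graded ideal exist (Hilbert) and are
   unique up to isomorphism; one of them is chosen here. *)
Definition min_resolution (K : fieldType) n (I : {mpoly K[n]} -> Prop) :
    free_complex K n :=
  epsilon (inhabits (zero_complex K n)) (minimal_graded_free_resolution I).

Definition graded_betti (K : fieldType) n (I : {mpoly K[n]} -> Prop)
    (i j : nat) : nat :=
  #|[set a : 'I_(frank (min_resolution I) i) | fdeg a == j]|.

(* The exterior algebra of a vector space with basis indexed by 'I_n: the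
   elements are the coordinate families with respect to the basis (e_s)_s. *)
Definition exterior (K : fieldType) (n : nat) : Type :=
  {ffun {set 'I_n} -> K^o}.

HB.instance Definition _ (K : fieldType) n :=
  Vector.copy (exterior K n) {ffun {set 'I_n} -> K^o}.

Section ExteriorAlgebra.

Variables (K : fieldType) (n : nat).
Implicit Types (A B C s t : {set 'I_n}) (f g h : exterior K n).

Definition ext_basis s : exterior K n := [ffun t => (t == s)%:R].

Definition inversions A B : nat :=
  #|[set p : 'I_n * 'I_n | [&& p.1 \in A, p.2 \in B & (p.2 < p.1)%N]]|.

Definition ext_basis_mul A B : exterior K n :=
  if [disjoint A & B] then (-1) ^+ inversions A B *: ext_basis (A :|: B) else 0.

Definition ext_mul f g : exterior K n :=
  \sum_A \sum_B (f A * g B) *: ext_basis_mul A B.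

Lemma ext_basisE f : f = \sum_A f A *: ext_basis A.
Proof.
apply/ffunP => s; rewrite sum_ffunE (bigD1 s) //= !ffunE eqxx [_ *: _]mulr1.
rewrite big1 ?addr0 // => t /negPf nts; rewrite !ffunE eq_sym nts.
exact: mulr0.
Qed.

Lemma ext_mulDl : left_distributive ext_mul +%R.
Proof.
move=> f g h; rewrite /ext_mul -big_split; apply: eq_bigr => A _ /=.
rewrite -big_split; apply: eq_bigr => B _ /=.
by rewrite !ffunE mulrDl scalerDl.
Qed.

Lemma ext_mulDr : right_distributive ext_mul +%R.
Proof.
move=> f g h; rewrite /ext_mul -big_split; apply: eq_bigr => A _ /=.
rewrite -big_split; apply: eq_bigr => B _ /=.
by rewrite !ffunE mulrDr scalerDl.
Qed.

Lemma ext_mulZl (c : K) f g : ext_mul (c *: f) g = c *: ext_mul f g.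
Proof.
rewrite /ext_mul scaler_sumr; apply: eq_bigr => A _ /=.
rewrite scaler_sumr; apply: eq_bigr => B _ /=.
by rewrite !ffunE scalerA mulrA.
Qed.

Lemma ext_mulZr (c : K) f g : ext_mul f (c *: g) = c *: ext_mul f g.
Proof.
rewrite /ext_mul scaler_sumr; apply: eq_bigr => A _ /=.
rewrite scaler_sumr; apply: eq_bigr => B _ /=.
by rewrite !ffunE scalerA mulrCA.
Qed.

Lemma ext_mul0l f : ext_mul 0 f = 0.
Proof. by have:= ext_mulZl 0 0 f; rewrite !scale0r. Qed.

Lemma ext_mul0r f : ext_mul f 0 = 0.
Proof. by have:= ext_mulZr 0 f 0; rewrite !scale0r. Qed.

Lemma ext_mul_suml (F : {set 'I_n} -> exterior K n) g :
  ext_mul (\sum_A F A) g = \sum_A ext_mul (F A) g.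
Proof. exact: (big_morph (ext_mul^~ g) (fun x y => ext_mulDl x y g) (ext_mul0l g)). Qed.

Lemma ext_mul_sumr (F : {set 'I_n} -> exterior K n) g :
  ext_mul g (\sum_A F A) = \sum_A ext_mul g (F A).
Proof. exact: (big_morph (ext_mul g) (ext_mulDr g) (ext_mul0r g)). Qed.

Lemma ext_mul_basis A B : ext_mul (ext_basis A) (ext_basis B) = ext_basis_mul A B.
Proof.
rewrite /ext_mul (bigD1 A) //= [X in _ + X]big1 ?addr0; last first.
  move=> C /negPf nCA; rewrite big1 // => D _.
  by rewrite !ffunE nCA mul0r scale0r.
rewrite (bigD1 B) //= [X in _ + X]big1 ?addr0; last first.
  by move=> C /negPf nCB; rewrite !ffunE nCB mulr0 scale0r.
by rewrite !ffunE !eqxx mulr1 scale1r.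
Qed.

Lemma inversionsUl A B C :
  [disjoint A & B] -> inversions (A :|: B) C = (inversions A C + inversions B C)%N.
Proof.
move=> dAB; rewrite /inversions -cardsUI [X in (_ = _ + X)%N](_ : _ = 0%N).
  rewrite addn0; apply: eq_card => p; rewrite !inE.
  by case: (_ \in A); case: (_ \in B); case: (_ \in C); case: (_ < _)%N.
apply: eq_card0 => p; rewrite !inE.
case pA: (p.1 \in A) => //=.
by rewrite (disjointFr dAB pA) andbF.
Qed.

Lemma inversionsUr A B C :
  [disjoint B & C] -> inversions A (B :|: C) = (inversions A B + inversions A C)%N.
Proof.
move=> dBC; rewrite /inversions -cardsUI [X in (_ = _ + X)%N](_ : _ = 0%N).
  rewrite addn0; apply: eq_card => p; rewrite !inE.
  by case: (_ \in A); case: (_ \in B); case: (_ \in C); case: (_ < _)%N.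
apply: eq_card0 => p; rewrite !inE.
case pB: (p.2 \in B); rewrite ?andbF //=.
by rewrite (disjointFr dBC pB) !andbF.
Qed.

Lemma ext_mul_basisA A B C :
  ext_mul (ext_basis A) (ext_mul (ext_basis B) (ext_basis C)) =
  ext_mul (ext_mul (ext_basis A) (ext_basis B)) (ext_basis C).
Proof.
rewrite !ext_mul_basis /ext_basis_mul.
case dBC: [disjoint B & C]; case dAB: [disjoint A & B];
  rewrite ?ext_mul0l ?ext_mul0r ?ext_mulZl ?ext_mulZr ?ext_mul_basis //
          /ext_basis_mul.
- rewrite -!setI_eq0 setIUl setIUr !setU_eq0 !setI_eq0 dAB dBC /= andbT.
  case: ifP => dAC; last by rewrite !scaler0.
  rewrite !scalerA -!exprD inversionsUl // inversionsUr // setUA.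
  by rewrite addnC addnA.
- by rewrite -setI_eq0 setIUr setU_eq0 !setI_eq0 dAB /= scaler0.
- by rewrite -setI_eq0 setIUl setU_eq0 !setI_eq0 dBC andbF scaler0.
Qed.

Lemma ext_mulA : associative ext_mul.
Proof.
move=> f g h; pose F A : exterior K n := f A *: ext_basis A.
pose G A : exterior K n := g A *: ext_basis A.
pose H A : exterior K n := h A *: ext_basis A.
have -> : f = \sum_A F A by exact: ext_basisE.
have -> : g = \sum_A G A by exact: ext_basisE.
have -> : h = \sum_A H A by exact: ext_basisE.
rewrite !(ext_mul_suml F) (ext_mul_suml (fun A => ext_mul (F A) _)).
apply: eq_bigr => A _; rewrite (ext_mul_suml G) (ext_mul_sumr G).
rewrite (ext_mul_sumr (fun B => ext_mul (G B) _)).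
rewrite (ext_mul_suml (fun B => ext_mul (F A) (G B))).
apply: eq_bigr => B _; rewrite !(ext_mul_sumr H).
rewrite (ext_mul_sumr (fun C => ext_mul (G B) (H C))).
apply: eq_bigr => C _.
rewrite /F /G /H !(ext_mulZl, ext_mulZr) ext_mul_basisA !scalerA.
by congr (_ *: _); rewrite -[RHS]mulrA [RHS]mulrC.
Qed.

Lemma ext_mul1l : left_id (ext_basis set0) ext_mul.
Proof.
move=> f; rewrite {1}[f]ext_basisE ext_mul_sumr [RHS]ext_basisE.
apply: eq_bigr => A _; rewrite ext_mulZr ext_mul_basis /ext_basis_mul.
rewrite -setI_eq0 set0I eqxx set0U /inversions (_ : [set _ | _] = set0).
  by rewrite cards0 scale1r.
by apply/setP => p; rewrite !inE.
Qed.

Lemma ext_mul1r : right_id (ext_basis set0) ext_mul.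
Proof.
move=> f; rewrite {1}[f]ext_basisE ext_mul_suml [RHS]ext_basisE.
apply: eq_bigr => A _; rewrite ext_mulZl ext_mul_basis /ext_basis_mul.
rewrite -setI_eq0 setI0 eqxx setU0 /inversions (_ : [set _ | _] = set0).
  by rewrite cards0 scale1r.
by apply/setP => p; rewrite !inE andbF.
Qed.

Lemma ext_1neq0 : ext_basis set0 != 0.
Proof.
by apply/eqP => /ffunP/(_ set0)/eqP; rewrite !ffunE eqxx oner_eq0.
Qed.

End ExteriorAlgebra.

HB.instance Definition _ (K : fieldType) n :=
  GRing.Zmodule_isNzRing.Build (exterior K n) (@ext_mulA K n)
    (@ext_mul1l K n) (@ext_mul1r K n) (@ext_mulDl K n) (@ext_mulDr K n)
    (@ext_1neq0 K n).

HB.instance Definition _ (K : fieldType) n :=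
  GRing.Lmodule_isLalgebra.Build K (exterior K n)
    (fun c f g => esym (ext_mulZl c f g)).

HB.instance Definition _ (K : fieldType) n :=
  GRing.Lalgebra_isAlgebra.Build K (exterior K n)
    (fun c f g => esym (ext_mulZr c f g)).

HB.instance Definition _ (K : fieldType) n :=
  Algebra_isFalgebra.Build K (exterior K n).

Section ExteriorBasis.

Variables (K : fieldType) (n : nat).

Definition ext_var (i : 'I_n) : exterior K n := ext_basis K [set i].

(* Big products over 'I_n are taken in increasing order, so this is
   e_s = e_(i_1) /\ ... /\ e_(i_r) for s = {i_1 < ... < i_r}. *)
Lemma ext_basis_prod (s : {set 'I_n}) :
  ext_basis K s = \prod_(i in s) ext_var i.
Proof.
have aux (l : seq 'I_n) : sorted ltn [seq val i | i <- l] ->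
    \prod_(i <- l) ext_var i = ext_basis K [set i in l].
  elim: l => [_|i l IHl].
    by rewrite big_nil; congr ext_basis; apply/setP => x; rewrite !inE.
  rewrite /= path_sortedE; last exact: ltn_trans.
  case/andP=> /allP il sl; rewrite big_cons IHl // [LHS]ext_mul_basis.
  have lt_il j : j \in l -> (i < j)%N by move=> jl; apply/il/map_f.
  rewrite /ext_basis_mul disjoints1 inE.
  case: ifP => [_|/negbFE/lt_il]; last by rewrite ltnn.
  rewrite (_ : inversions _ _ = 0%N) ?scale1r.
    by congr ext_basis; apply/setP => x; rewrite !inE.
  apply: eq_card0 => -[a b]; rewrite !inE /=.
  apply/and3P => -[/eqP-> /lt_il ib bi].
  by have:= ltn_trans ib bi; rewrite ltnn.
rewrite -big_filter aux.
  congr ext_basis; apply/setP => x.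
  by rewrite inE mem_filter mem_index_enum andbT.
rewrite sorted_map; apply: sorted_filter; first by move=> y x z; apply: ltn_trans.
rewrite -sorted_map [index_enum _]unlock -enumT val_enum_ord.
exact: iota_ltn_sorted.
Qed.

Lemma ext_var_sqr (i : 'I_n) : ext_var i * ext_var i = 0.
Proof.
by rewrite [LHS]ext_mul_basis /ext_basis_mul disjoints1 inE eqxx.
Qed.

End ExteriorBasis.

Definition ext_SR_ideal (K : fieldType) n (D : {set {set 'I_n}}) :
    exterior K n -> Prop :=
  ideal_gen (fun f => exists2 s : {set 'I_n}, s \notin D & f = ext_basis K s).
Arguments ext_SR_ideal K {n} D _.

(* The algebra endomorphism of the exterior algebra induced by the linear map
   e_i |-> \sum_j g_(j, i) e_j. *)
Definition ext_act (K : fieldType) n (g : 'M[K]_n) (f : exterior K n) :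
    exterior K n :=
  \sum_(s : {set 'I_n})
    f s *: \prod_(i in s) \sum_(j < n) g j i *: ext_var K j.

Definition ext_image (K : fieldType) n (g : 'M[K]_n)
    (J : exterior K n -> Prop) : exterior K n -> Prop :=
  fun f => exists2 h, J h & f = ext_act g h.

(* e_s < e_t in the (degree) reverse lexicographic order with
   e_1 > ... > e_n: |s| < |t|, or |s| = |t| and the largest index at which s
   and t differ belongs to s. *)
Definition revlex_lt n (s t : {set 'I_n}) : bool :=
  (#|s| < #|t|)%N ||
  (#|s| == #|t|) &&
  [exists i in s :\: t,
     forall j : 'I_n, (i < j)%N ==> ((j \in s) == (j \in t))].

Definition is_initial (K : fieldType) n (f : exterior K n) (s : {set 'I_n}) :
    Prop :=
  f s != 0 /\ forall t, f t != 0 -> t != s -> revlex_lt t s.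

Definition initial_ideal (K : fieldType) n (J : exterior K n -> Prop) :
    exterior K n -> Prop :=
  ideal_gen (fun f => exists h s,
    [/\ J h, is_initial h s & f = ext_basis K s]).

(* Polynomials in the n * n matrix entries, indexed as in mxvec. *)
Definition zariski_open_GL (K : fieldType) n (U : 'M[K]_n -> Prop) : Prop :=
  (forall g, U g -> g \in unitmx) /\
  exists P : {mpoly K[n * n]} -> Prop, forall g, g \in unitmx ->
    (U g <-> exists2 p, P p & p.@[fun k => mxvec g 0 k] != 0).

Definition is_gin (K : fieldType) n (J G : exterior K n -> Prop) : Prop :=
  exists U : 'M[K]_n -> Prop,
    [/\ zariski_open_GL U, (exists g, U g)
      & forall g, U g -> forall f, initial_ideal (ext_image g J) f <-> G f].

Definition is_exterior_shifting (K : fieldType) n (D De : {set {set 'I_n}}) :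
    Prop :=
  simplicial_complex De /\ is_gin (ext_SR_ideal K D) (ext_SR_ideal K De).

(* Main.v *)
From HB Require Import structures.
Require Import Defs.
From mathcomp Require Import all_boot all_order all_algebra.
From mathcomp Require Import mpoly zify.
From Stdlib Require Import ClassicalEpsilon.

Set Implicit Arguments.
Unset Strict Implicit.
Unset Printing Implicit Defensive.

Import GRing.Theory.
Local Open Scope ring_scope.

(** The Betti numbers of a squarefree stable ideal are given by a formula that
    only involves the numbers of its squarefree monomials of degree j in the
    first k variables, and a generic change of coordinates in the exterior
    algebra does not alter these numbers.

    Let N be the family of supports of the squarefree monomials of the ideal
    (the non-faces of the complex), and m(u) the largest index of u. Sort the
    minimal generators by degree and then by m(u). By stability, the colon
    ideal of a generator u by the preceding ones is generated by the variables
    x_t with t < m(u) and t not in u ([linear_quotients]). Hence the ideal is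
    obtained by successive extensions by shifted Koszul modules on m(u) - |u|
    variables. Adding the Koszul complexes one at a time with the horseshoe
    lemma gives a free resolution ([resolution_exists]); it is minimal, since
    the generators come in increasing degree and the connecting maps therefore
    have entries of positive degree. Its graded ranks are the Betti numbers
    because any two minimal resolutions have the same graded ranks
    ([graded_bettiE]): the comparison maps between them are mutually inverse
    modulo the variables. This is the squarefree Eliahou-Kervaire formula
    ([graded_betti_stable]). A member of N is a minimal generator exactly when
    removing its largest element leads out of N, so the number of generators
    with given degree and given m(u) is determined by the numbers of s in N
    with |s| = j and s contained in {1, ..., k} ([ek_count_eq]).

    It remains to compare the complex with its exterior shifting. Let J be the
    exterior ideal of the complex and g a generic matrix.

    - The generic initial ideal is stable ([gin_stable]). If e_s is the initial
      monomial of an element of g J and i < m with m in s and i not in s, the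
      shear e_m -> e_m + c e_i sends this element to one with initial monomial
      e_t, where t is s with m replaced by i; and for almost all c the sheared
      matrix is again generic.

    - The counts agree ([gin_segment_count]). For the reverse lexicographic
      order, the initial monomials of degree j in e_1, ..., e_k number as many
      as the dimension of the projection of (g J)_j to the exterior algebra of
      the first k coordinates. If the leading minors of g are nonzero, the
      projection of g e_m with m > k is a combination of those of g e_i with
      i <= k. Stability of J then allows one to replace, in the projection of
      g e_s with e_s in J, the indices beyond k one after the other, starting
      with the largest. So the projection is spanned by the images of the
      e_t in J with t contained in {1, ..., k}, and these are independent. *)

(** * Homogeneous matrices over a polynomial ring *)

Section GradedMatrices.

Variables (K : fieldType) (n : nat).
Local Notation S := {mpoly K[n]}.
Implicit Types (p q : S).

(** Coefficientwise form of [entry_of_degree]: without the case distinction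
    and the truncated subtraction, sums and products need no arithmetic. *)
Definition entry_deg (a b : nat) p :=
  forall m : 'X_{1..n}, p@_m != 0 -> (mdeg m + b)%N = a.

Lemma entry_degP a b p : entry_of_degree a b p <-> entry_deg a b p.
Proof.
rewrite /entry_of_degree /entry_deg; case: leqP => ab.
  split=> [/dhomogP h m|h]; last apply/dhomogP => m.
    by rewrite -mcoeff_msupp => /h ->; rewrite subnK.
  by rewrite mcoeff_msupp => /h <-; rewrite addnK.
split=> [/eqP-> m|h]; first by rewrite mcoeff0 eqxx.
apply/eqP/mpolyP => m; rewrite mcoeff0; apply/eqP/negPn/negP => /h e.
by move: ab; rewrite -e ltnNge leq_addl.
Qed.

Lemma mcoeffM_neq0 p q m : (p * q)@_m != 0 ->
  exists m1 m2, [/\ p@_m1 != 0, q@_m2 != 0 & m = (m1 + m2)%MM].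
Proof.
rewrite -mcoeff_msupp => /msuppM_le/allpairsP[[m1 m2] /= [h1 h2 ->]].
by exists m1, m2; rewrite -!mcoeff_msupp.
Qed.

Lemma entry_deg0 a b : entry_deg a b 0.
Proof. by move=> m; rewrite mcoeff0 eqxx. Qed.

Lemma entry_degX (i : 'I_n) a : entry_deg a.+1 a 'X_i.
Proof.
by move=> m; rewrite mcoeffX; have [<-|] := eqVneq U_(i)%MM m;
  rewrite ?eqxx ?mdeg1.
Qed.

Lemma entry_degD a b p q : entry_deg a b p -> entry_deg a b q ->
    entry_deg a b (p + q).
Proof.
move=> hp hq m; rewrite mcoeffD; have [p0|/hp //] := eqVneq p@_m 0.
by rewrite p0 add0r => /hq.
Qed.

Lemma entry_degN a b p : entry_deg a b p -> entry_deg a b (- p).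
Proof. by move=> hp m; rewrite mcoeffN oppr_eq0 => /hp. Qed.

Lemma entry_degM a b c p q : entry_deg a b p -> entry_deg b c q ->
    entry_deg a c (p * q).
Proof.
move=> hp hq m /mcoeffM_neq0[m1 [m2 [/hp <- /hq <- ->]]].
by rewrite mdegD addnA.
Qed.

Lemma entry_degZ (c : K) a b p : entry_deg a b p -> entry_deg a b (c *: p).
Proof. by move=> hp m; rewrite mcoeffZ mulf_eq0 negb_or => /andP[_ /hp]. Qed.

Lemma entry_deg_sum I (r : seq I) (P : pred I) (F : I -> S) a b :
  (forall i, P i -> entry_deg a b (F i)) ->
    entry_deg a b (\sum_(i <- r | P i) F i).
Proof.
by move=> h; elim/big_ind: _ => //; [apply: entry_deg0|apply: entry_degD].
Qed.

Definition graded_mx (p q : nat) (ra : 'I_p -> nat) (rb : 'I_q -> nat)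
    (M : 'M[S]_(p, q)) :=
  forall a b, entry_deg (ra a) (rb b) (M a b).

Lemma graded_mulmx (p q r : nat) (ra : 'I_p -> nat) (rb : 'I_q -> nat)
    (rc : 'I_r -> nat)
    M N : graded_mx ra rb M -> graded_mx rb rc N -> graded_mx ra rc (M *m N).
Proof.
move=> hM hN a c; rewrite mxE; apply: entry_deg_sum => b _.
exact: entry_degM (hM a b) (hN b c).
Qed.

Lemma graded_oppmx (p q : nat) (ra : 'I_p -> nat) (rb : 'I_q -> nat) M :
  graded_mx ra rb M -> graded_mx ra rb (- M).
Proof. by move=> hM a b; rewrite mxE; apply: entry_degN. Qed.

Definition mfilter (P : pred 'X_{1..n}) p : S :=
  \sum_(m <- msupp p | P m) p@_m *: 'X_[m].

Lemma mcoeff_mfilter P p m : (mfilter P p)@_m = if P m then p@_m else 0.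
Proof.
rewrite /mfilter raddf_sum /=; case: ifP => h.
  have [mp|mp] := boolP (m \in msupp p).
    rewrite (big_rem m) //= h mcoeffZ mcoeffX eqxx mulr1 big_seq_cond big1
      ?addr0 //.
    move=> k; rewrite (mem_rem_uniq m (msupp_uniq p)) inE =>
      /andP[/andP[km _] _].
    by rewrite mcoeffZ mcoeffX (negPf km) mulr0.
  rewrite (memN_msupp_eq0 mp) big_seq_cond big1 // => k /andP[kp _].
  rewrite mcoeffZ mcoeffX; case: eqP => [km|]; last by rewrite mulr0.
  by move: mp; rewrite -km kp.
rewrite big1 // => k hk; rewrite mcoeffZ mcoeffX.
by case: eqP => [km|]; rewrite ?mulr0 //; move: h; rewrite -km hk.
Qed.

(** The component of p that can serve as an entry S(-a) -> S(-b). *)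
Definition hpart (a b : nat) p : S :=
  mfilter (fun m => (mdeg m + b)%N == a) p.

Lemma mcoeff_hpart a b p m :
  (hpart a b p)@_m = if (mdeg m + b)%N == a then p@_m else 0.
Proof. exact: mcoeff_mfilter. Qed.

Lemma entry_deg_hpart a b p : entry_deg a b (hpart a b p).
Proof.
by move=> m; rewrite mcoeff_hpart; case: ifP => [/eqP//|_]; rewrite eqxx.
Qed.

Lemma hpart_id a b p : entry_deg a b p -> hpart a b p = p.
Proof.
move=> hp; apply/mpolyP => m; rewrite mcoeff_hpart; case: eqP => // h.
by apply/esym/eqP; apply: contra_notT h => /hp.
Qed.

Lemma hpart_sum I (r : seq I) (F : I -> S) a b :
  hpart a b (\sum_(i <- r) F i) = \sum_(i <- r) hpart a b (F i).
Proof.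
apply/mpolyP => m; rewrite mcoeff_hpart !raddf_sum /=.
case: ifP => h; last by rewrite big1 // => i _; rewrite mcoeff_hpart h.
by apply: eq_bigr => i _; rewrite mcoeff_hpart h.
Qed.

(** Right multiplication by a homogeneous entry shifts degrees uniformly, so
    it commutes with taking components; this is what lets an arbitrary lift be
    replaced by a homogeneous one. *)
Lemma hpartM a b c p q :
  entry_deg b c q -> hpart a c (p * q) = hpart a b p * q.
Proof.
move=> hq; have -> : p * q = \sum_(m <- msupp p) (p@_m *: 'X_[m]) * q.
  by rewrite -mulr_suml -mpolyE.
rewrite hpart_sum [in RHS]/hpart [in RHS]/mfilter [in RHS]big_mkcond mulr_suml;
  apply: eq_bigr => m _.
have hmq : entry_deg (mdeg m + b) c (p@_m *: 'X_[m] * q).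
  apply: entry_degM hq; apply: entry_degZ => k; rewrite mcoeffX.
  by have [->|] := eqVneq m k; rewrite ?eqxx.
case: eqP => [e|ne]; first by rewrite hpart_id // -e.
rewrite mul0r; apply/mpolyP => k; rewrite mcoeff_hpart mcoeff0.
case: eqP => // ke; apply/eqP; apply: contra_notT ne => /hmq <-.
by rewrite ke.
Qed.

(** Lift the rows arbitrarily and keep only the components of the right
    degrees: since both M and D are homogeneous, the discarded components
    contribute nothing to M. *)
Lemma graded_lift (p q r : nat) (ra : 'I_p -> nat) (rb : 'I_q -> nat)
    (rc : 'I_r -> nat)
    (M : 'M[S]_(p, r)) (D : 'M[S]_(q, r)) :
  graded_mx ra rc M -> graded_mx rb rc D ->
  (forall a, exists w : 'rV_q, row a M = w *m D) ->
  exists2 N : 'M_(p, q), graded_mx ra rb N & M = N *m D.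
Proof.
move=> hM hD /fin_all_exists[w hw].
exists (\matrix_(a, b) hpart (ra a) (rb b) (w a 0 b)).
  by move=> a b; rewrite mxE; apply: entry_deg_hpart.
apply/matrixP => a c; rewrite mxE -[LHS](hpart_id (hM a c)).
have -> : M a c = \sum_b w a 0 b * D b c.
  by have /rowP/(_ c) := hw a; rewrite !mxE.
by rewrite hpart_sum; apply: eq_bigr => b _; rewrite mxE; apply: hpartM.
Qed.

Lemma mx_lift (p q r : nat) (M : 'M[S]_(p, r)) (D : 'M[S]_(q, r)) :
  (forall a, exists w : 'rV_q, row a M = w *m D) ->
  exists N : 'M_(p, q), M = N *m D.
Proof.
move=> /fin_all_exists[w hw]; exists (\matrix_a w a).
by apply/row_matrixP => a; rewrite row_mul rowK.
Qed.

End GradedMatrices.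

(** * Graded ranks of a minimal resolution are unique *)

(** Comparison maps, homotopies and connecting maps are all built degree by
    degree, each stage depending on the previous one; P carries the condition
    under which the next stage exists. *)
Lemma dependent_sequence (T : nat -> Type) (P : forall i, T i -> Prop)
    (R : forall i, T i -> T i.+1 -> Prop) (x0 : T 0) :
  P 0 x0 -> (forall i x, P i x -> exists2 y, P i.+1 y & R i x y) ->
  exists s : forall i, T i, [/\ s 0 = x0, forall i, P i (s i)
    & forall i, R i (s i) (s i.+1)].
Proof.
move=> P0 step.
have next i (x : {x | P i x}) : {y : {y | P i.+1 y} | R i (sval x) (sval y)}.
  apply: constructive_indefinite_description.
  by case: x => x /= /step[y Py Rxy]; exists (exist _ y Py).
pose s := fix s i : {x | P i x} :=
  if i is i'.+1 then sval (next i' (s i')) else exist _ x0 P0.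
exists (fun i => sval (s i)); split=> // i; first exact: (svalP (s i)).
exact: (svalP (next i (s i))).
Qed.

Section Uniqueness.

Variables (K : fieldType) (n : nat).
Local Notation S := {mpoly K[n]}.
Implicit Types (F G : free_complex K n) (I : S -> Prop).

Definition fcount F i j := #|[set a : 'I_(frank F i) | fdeg a == j]|.

Lemma graded_complexE F : graded_complex F <->
  graded_mx (@fdeg _ _ F 0) (fun=> 0%N) (faug F) /\
  forall i, graded_mx (@fdeg _ _ F i.+1) (@fdeg _ _ F i) (fdiff F i).
Proof.
split=> -[h1 h2]; split.
- by move=> a b; apply/entry_degP; rewrite ord1; apply: h1.
- by move=> i a b; apply/entry_degP; apply: h2.
- by move=> a; apply/entry_degP; apply: h1.
- by move=> i a b; apply/entry_degP; apply: h2.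
Qed.

(** Minimality is thereby a statement about reducing matrices modulo the
    variables, which is the ring morphism [mcoeff 0]. *)
Lemma max_idealP (p : S) :
  ideal_gen (fun p => exists k : 'I_n, p = 'X_k) p <-> p@_0%MM = 0.
Proof.
split=> [h|h].
  apply: (h (fun p => p@_0%MM = 0)) => [|b [k ->]].
    split=> [|a b ha hb|r a ha]; first exact: mcoeff0.
      by rewrite mcoeffD ha hb addr0.
    by rewrite !rmorphM /= ha mulr0 mul0r.
  by rewrite mcoeffX mnm1_eq0.
move=> I [I0 ID IM] IX; rewrite [p]mpolyE big_seq.
elim/big_ind: _ => // m mp.
have [m0|] := eqVneq m 0%MM; first by rewrite m0 h scale0r.
case: (pickP (fun i => m i != 0%N)) => [i mi _|m0 /eqP[]]; last first.
  by apply/mnmP => i; rewrite mnm0E; apply/eqP; move: (m0 i) => /negbFE.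
rewrite -(submK (_ : U_(i) <= m)%MM) ?lep1mP // mpolyXD -mul_mpolyC mulrA.
by apply: (IM _ _ _).1; apply: IX; exists i.
Qed.

Lemma minimal_complexP F :
  minimal_complex F <-> forall i, map_mx (mcoeff 0%MM) (fdiff F i) = 0.
Proof.
split=> [h i|h i a b].
  by apply/matrixP => a b; rewrite !mxE; apply/max_idealP.
by apply/max_idealP; move/matrixP/(_ a b): (h i); rewrite !mxE.
Qed.

Lemma mulmx_rows0 (p q r : nat) (A : 'M[S]_(p, q)) (B : 'M[S]_(q, r)) :
  (forall v : 'rV_q, (exists w, v = w *m A) -> v *m B = 0) -> A *m B = 0.
Proof.
move=> h; apply/row_matrixP => a; rewrite row_mul row0.
by apply: h; exists (delta_mx 0 a); rewrite -rowE.
Qed.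

Lemma fdiff_aug F I : resolves F I -> fdiff F 0 *m faug F = 0.
Proof. by case=> _ h _; apply: mulmx_rows0 => v /h. Qed.

Lemma fdiff_fdiff F I i : resolves F I -> fdiff F i.+1 *m fdiff F i = 0.
Proof. by case=> _ _ h; apply: mulmx_rows0 => v /h. Qed.

Lemma exact_rows (F : free_complex K n) I i (p : nat)
    (M : 'M[S]_(p, frank F i.+1)) :
  resolves F I -> M *m fdiff F i = 0 ->
  forall a, exists w : 'rV_(frank F i.+2), row a M = w *m fdiff F i.+1.
Proof. by case=> _ _ h M0 a; apply/h; rewrite -row_mul M0 row0. Qed.

Lemma exact_rows0 (F : free_complex K n) I (p : nat)
    (M : 'M[S]_(p, frank F 0)) :
  resolves F I -> M *m faug F = 0 ->
  forall a, exists w : 'rV_(frank F 1), row a M = w *m fdiff F 0.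
Proof. by case=> _ h _ M0 a; apply/h; rewrite -row_mul M0 row0. Qed.

(** The identity of I lifts to a chain map between resolutions. At each stage
    the rows to be lifted are cycles, hence boundaries, and [graded_lift]
    keeps the lift homogeneous. *)
Lemma comparison F G I : graded_complex F -> graded_complex G ->
  resolves F I -> resolves G I ->
  exists phi : forall i, 'M[S]_(frank F i, frank G i),
    [/\ forall i, graded_mx (@fdeg _ _ F i) (@fdeg _ _ G i) (phi i),
        phi 0 *m faug G = faug F
      & forall i, phi i.+1 *m fdiff G i = fdiff F i *m phi i].
Proof.
move=> /graded_complexE[aF dF] /graded_complexE[aG dG] rF rG.
have [|phi0 gphi0 phi0E] := graded_lift aF aG.
  move=> a; case: rF rG => IF _ _ [IG _ _].
  have /IG[w waug] : I (faug F a 0).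
    by apply/IF; exists (delta_mx 0 a); rewrite -rowE mxE.
  by exists w; apply/rowP => b; rewrite ord1 -waug mxE.
have [||phi [p0 gphi dphi]] := @dependent_sequence
  (fun i => 'M[S]_(frank F i, frank G i))
  (fun i f => graded_mx (@fdeg _ _ F i) (@fdeg _ _ G i) f /\
     forall a, exists w, row a (fdiff F i *m f) = w *m fdiff G i)
  (fun i f g => g *m fdiff G i = fdiff F i *m f) phi0.
- split=> //; apply: (exact_rows0 rG).
  by rewrite -mulmxA -phi0E (fdiff_aug rF).
- move=> i f [gf /(graded_lift (graded_mulmx (dF i) gf) (dG i))[g gg gE]].
  exists g => //; split=> //; apply: (exact_rows rG).
  by rewrite -mulmxA -gE mulmxA (fdiff_fdiff _ rF) mul0mx.
exists phi; split=> // [i|]; first by case: (gphi i).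
by rewrite p0.
Qed.

(** A chain endomorphism lifting the identity is homotopic to the identity:
    chi - 1 = h d + d h. Minimality kills both terms modulo the variables. *)
Lemma endomorphism_id F I (chi : forall i, 'M[S]_(frank F i)) :
  resolves F I -> minimal_complex F ->
  chi 0 *m faug F = faug F ->
  (forall i, chi i.+1 *m fdiff F i = fdiff F i *m chi i) ->
  forall i, map_mx (mcoeff 0%MM) (chi i) = 1%:M.
Proof.
move=> rF /minimal_complexP mF chi0 chiS.
(* The homotopy starts from h0 with chi 0 - 1 = h0 d, and h' is chosen so that
   chi - 1 - d h = h' d in the next degree. *)
have [|h0 h0E] := @mx_lift _ _ _ _ _ (chi 0 - 1%:M) (fdiff F 0).
  by apply: (exact_rows0 rF); rewrite mulmxBl chi0 mul1mx subrr.
have [||h [p0 _ hS]] := @dependent_sequence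
  (fun i => 'M[S]_(frank F i, frank F i.+1))
  (fun i h => (chi i.+1 - 1%:M - fdiff F i *m h) *m fdiff F i = 0)
  (fun i h h' => chi i.+1 - 1%:M - fdiff F i *m h = h' *m fdiff F i.+1) h0.
- rewrite !mulmxBl mul1mx chiS -mulmxA -h0E mulmxBr mulmx1.
  by rewrite subrr.
- move=> i h hE; have [h' h'E] := mx_lift (exact_rows rF hE).
  exists h' => //.
  rewrite !mulmxBl mul1mx chiS -mulmxA -h'E !mulmxBr mulmx1.
  rewrite (mulmxA _ _ h) (fdiff_fdiff _ rF) mul0mx subr0.
  by rewrite subrr.
case=> [|i].
  move/(congr1 (map_mx (mcoeff 0%MM))): h0E;
    rewrite map_mxB map_mx1 map_mxM mF mulmx0.
  by move/eqP; rewrite subr_eq0 => /eqP.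
move/(congr1 (map_mx (mcoeff 0%MM))): (hS i).
rewrite !map_mxB map_mx1 !map_mxM !mF mulmx0 mul0mx subr0.
by move/eqP; rewrite subr_eq0 => /eqP.
Qed.

(** As X preserves degrees, the product X Y = 1 restricts to the block of rows
    of degree j and factors there through the columns of degree j; a matrix
    with a right inverse has at most as many rows as columns. Ranks are
    compared rather than traces, which would only give the equality modulo the
    characteristic. *)
Lemma graded_inverse_card (p q : nat) (ra : 'I_p -> nat) (rb : 'I_q -> nat)
    (X : 'M[K]_(p, q)) (Y : 'M[K]_(q, p)) j :
  X *m Y = 1%:M -> (forall a b, X a b != 0 -> ra a = rb b) ->
  (#|[set a | ra a == j]| <= #|[set b | rb b == j]|)%N.
Proof.
move=> XY hX; set A := [set a | _]; set B := [set b | _].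
pose X' := \matrix_(a < #|A|, b < #|B|) X (enum_val a) (enum_val b).
pose Y' := \matrix_(b < #|B|, a < #|A|) Y (enum_val b) (enum_val a).
apply: (@mulmx1_min _ _ _ X' Y'); apply/matrixP => a c.
have := congr1 (fun M : 'M__ => M (enum_val a) (enum_val c)) XY.
rewrite !mxE (inj_eq enum_val_inj) => <-; rewrite (bigID (mem B)) /=.
rewrite [X in _ = _ + X]big1 ?addr0 => [|b bB].
  by rewrite [RHS]big_enum_val; apply: eq_bigr => b _; rewrite !mxE.
apply/eqP; rewrite mulf_eq0; apply/orP; left; apply: contraNT bB => /hX e.
by have := enum_valP a; rewrite !inE -e.
Qed.

(** Composing the comparison maps in both directions gives an endomorphism of
    F over the identity, so modulo the variables phi has a right inverse. *)
Lemma fcount_le F G I i j : graded_complex F -> graded_complex G ->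
  resolves F I -> resolves G I -> minimal_complex F ->
  (fcount F i j <= fcount G i j)%N.
Proof.
move=> gF gG rF rG mF.
have [phi [gphi phi0 phiS]] := comparison gF gG rF rG.
have [psi [_ psi0 psiS]] := comparison gG gF rG rF.
apply: (@graded_inverse_card _ _ _ _ (map_mx (mcoeff 0%MM) (phi i))
          (map_mx (mcoeff 0%MM) (psi i))).
  rewrite -map_mxM; apply:
    (endomorphism_id (chi := fun i => phi i *m psi i) rF mF).
    by rewrite -mulmxA psi0.
  by move=> k; rewrite -mulmxA psiS mulmxA phiS mulmxA.
by move=> a b; rewrite mxE => /gphi; rewrite mdeg0 add0n => ->.
Qed.

(** The chosen resolution is minimal as soon as one minimal resolution exists,
    and then all of them have the same graded ranks. *)
Lemma graded_bettiE I F i j : minimal_graded_free_resolution I F ->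
  graded_betti I i j = fcount F i j.
Proof.
move=> minF.
have [gM rM mM] := epsilon_spec (inhabits (zero_complex K n)) _
  (ex_intro _ F minF).
case: minF => gF rF mF.
by apply/eqP; rewrite eqn_leq
  !(fcount_le _ _ _ _ rF rM, fcount_le _ _ _ _ rM rF).
Qed.

End Uniqueness.

(** * Resolutions of subquotients: Koszul cones and extensions *)

Section Subquotients.

Variables (K : fieldType) (n : nat).
Local Notation S := {mpoly K[n]}.
Implicit Types (F G : free_complex K n) (A B : S -> Prop).

(** F resolves the module A / B. All modules met below, such as S / (x_t, t in
    T) up to a shift, are subquotients A / B of the ring. *)
Definition resolves_quot F A B :=
  [/\ (forall p, A p <-> exists (v : 'rV_(frank F 0)) q,
         B q /\ p = (v *m faug F) 0 0 + q),
      (forall v : 'rV_(frank F 0),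
         B ((v *m faug F) 0 0) <-> exists w, v = w *m fdiff F 0)
    & forall i (v : 'rV_(frank F i.+1)),
        v *m fdiff F i = 0 <-> exists w, v = w *m fdiff F i.+1].

Lemma mx11_eq0 (M : 'M[S]_1) : M = 0 <-> M 0 0 = 0.
Proof.
by split=> [->|h]; rewrite ?mxE //; apply/matrixP => a b; rewrite !ord1 h mxE.
Qed.

Lemma resolves_quot0 F A : resolves_quot F A (fun p => p = 0) <-> resolves F A.
Proof.
split=> -[h0 h1 h2]; split=> // [p|v].
- rewrite h0; split=> [[v [_ [-> ->]]]|[v ->]]; exists v; rewrite ?addr0 //.
  by exists 0; rewrite addr0.
- by rewrite -h1; apply: mx11_eq0.
- rewrite h0; split=> [[v ->]|[v [_ [-> ->]]]]; exists v; rewrite ?addr0 //.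
  by exists 0; rewrite addr0.
- by rewrite -h1; symmetry; apply: mx11_eq0.
Qed.

Lemma quot_fdiff_fdiff F A B i : resolves_quot F A B ->
  fdiff F i.+1 *m fdiff F i = 0.
Proof. by case=> _ _ h; apply: mulmx_rows0 => v /h. Qed.

Definition sumdeg (p q : nat) (ra : 'I_p -> nat) (rb : 'I_q -> nat)
  (a : 'I_(p + q)) := match split a with inl b => ra b | inr b => rb b end.

Lemma sumdegl (p q : nat) (ra : 'I_p -> nat) (rb : 'I_q -> nat) a :
  sumdeg ra rb (lshift q a) = ra a.
Proof. by rewrite /sumdeg (unsplitK (inl a)). Qed.

Lemma sumdegr (p q : nat) (ra : 'I_p -> nat) (rb : 'I_q -> nat) a :
  sumdeg ra rb (rshift p a) = rb a.
Proof. by rewrite /sumdeg (unsplitK (inr a)). Qed.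

(** The mapping cone of multiplication by x on F. Multiplication is already a
    chain map, so the differential is explicit and no lifting is needed. *)
Definition kcone_rank F i :=
  if i is i'.+1 then (frank F i + frank F i')%N else frank F 0.

Definition kcone_deg F i : 'I_(kcone_rank F i) -> nat :=
  match i with
  | 0 => @fdeg _ _ F 0
  | i'.+1 => sumdeg (@fdeg _ _ F i'.+1) (fun b => (@fdeg _ _ F i' b).+1)
  end.

Definition kcone_diff F (x : S) i :
    'M[S]_(kcone_rank F i.+1, kcone_rank F i) :=
  match i with
  | 0 => col_mx (fdiff F 0) x%:M
  | i'.+1 => block_mx (fdiff F i'.+1) 0 x%:M (- fdiff F i')
  end.

Definition kcone F x := @FreeComplex K n (kcone_rank F) (@kcone_deg F)
  (@kcone_diff F x) (faug F).

Lemma graded_block_mx (p1 p2 q1 q2 : nat) (ra1 : 'I_p1 -> nat)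
    (ra2 : 'I_p2 -> nat)
    (rb1 : 'I_q1 -> nat) (rb2 : 'I_q2 -> nat) (M1 : 'M[S]__) M2 M3 M4 :
  graded_mx ra1 rb1 M1 -> graded_mx ra1 rb2 M2 -> graded_mx ra2 rb1 M3 ->
  graded_mx ra2 rb2 M4 ->
  graded_mx (sumdeg ra1 ra2) (sumdeg rb1 rb2) (block_mx M1 M2 M3 M4).
Proof.
move=> h1 h2 h3 h4 a b.
rewrite -(splitK a) -(splitK b); case: (split a) (split b) => a' [] b' /=;
by rewrite ?sumdegl ?sumdegr
  ?(block_mxEul, block_mxEur, block_mxEdl, block_mxEdr).
Qed.

Lemma graded_col_mx (p1 p2 q : nat) (ra1 : 'I_p1 -> nat) (ra2 : 'I_p2 -> nat)
    (rb : 'I_q -> nat) (M1 : 'M[S]__) M2 :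
  graded_mx ra1 rb M1 -> graded_mx ra2 rb M2 ->
  graded_mx (sumdeg ra1 ra2) rb (col_mx M1 M2).
Proof.
move=> h1 h2 a b; rewrite -(splitK a); case: (split a) => a' /=;
by rewrite ?sumdegl ?sumdegr ?(col_mxEu, col_mxEd).
Qed.

Lemma graded_mx0 (p q : nat) (ra : 'I_p -> nat) (rb : 'I_q -> nat) :
  graded_mx ra rb (0 : 'M[S]_(p, q)).
Proof. by move=> a b; rewrite mxE; apply: entry_deg0. Qed.

Lemma graded_scalar_mx (p : nat) (ra : 'I_p -> nat) (t : 'I_n) :
  graded_mx (fun a => (ra a).+1) ra (('X_t)%:M : 'M[S]_p).
Proof.
move=> a b; rewrite mxE; case: eqP => [->|_]; last exact: entry_deg0.
by rewrite mulr1n; apply: entry_degX.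
Qed.

Lemma kcone_graded F t : graded_complex F -> graded_complex (kcone F 'X_t).
Proof.
move=> /graded_complexE[aF dF]; apply/graded_complexE; split=> // -[|i].
  exact: (graded_col_mx (dF 0) (@graded_scalar_mx _ (@fdeg _ _ F 0) t)).
apply: (graded_block_mx (dF i.+1) (graded_mx0 _ _)
  (@graded_scalar_mx _ (@fdeg _ _ F i.+1) t)).
by move=> a b m h; rewrite addnS (graded_oppmx (dF i) h).
Qed.

Lemma kcone_minimal F t : minimal_complex F -> minimal_complex (kcone F 'X_t).
Proof.
have X0 p : map_mx (mcoeff 0%MM) (('X_t)%:M : 'M[S]_p) = 0.
  by rewrite map_scalar_mx /= mcoeffX mnm1_eq0 raddf0.
move=> /minimal_complexP mF; apply/minimal_complexP => -[|i] /=.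
  by rewrite map_col_mx mF X0 col_mx0.
by rewrite map_block_mx map_mxN !mF X0 map_mx0 oppr0 block_mx0.
Qed.

(** If x is a nonzerodivisor on A / B then the cone resolves A / (B + x A): a
    cycle (a, b) of the cone has b = w d by exactness of F, and then a + x w
    is a cycle of F. In the lowest degree, being a cycle only says that x kills
    the image of b in A / B, and the hypothesis on x gives that this image is
    zero. *)
Lemma kcone_resolves F A B x : is_ideal B -> is_ideal A ->
  (forall p, A p -> B (x * p) -> B p) ->
  resolves_quot F A B ->
  resolves_quot (kcone F x) A
    (fun p => exists a b, [/\ A a, B b & p = x * a + b]).
Proof.
move=> [B0 BD BM] [A0 AD AM] nzd rF.
have dd i := quot_fdiff_fdiff i rF.
have [h0 h1 h2] := rF.
have BA b : B b -> A b.
  by move=> Bb; apply/h0; exists 0, b; rewrite mul0mx mxE add0r.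
have BN b : B b -> B (- b) by rewrite -mulN1r => /(BM (-1))[].
have augA (v : 'rV_(frank F 0)) : A ((v *m faug F) 0 0).
  by apply/h0; exists v, 0; rewrite addr0.
have augZ (v : 'rV_(frank F 0)) :
    ((x *: v) *m faug F) 0 0 = x * (v *m faug F) 0 0.
  by rewrite -scalemxAl mxE.
split=> [p|v|[|i] v].
- split=> [/h0[v [q [Bq ->]]]|[v [_ [[a [b [Aa Bb ->]]] ->]]]].
    by exists v, q; split=> //; exists 0, q; rewrite mulr0 add0r.
  by apply: (AD _ _ (augA _)); apply: AD; [apply: (AM _ _ Aa).1|apply: BA].
- split=> [[a [b [/h0[v' [b' [Bb' ->]]] Bb e]]]|[w ->]].
    have /h1[w we] : B (((v - x *: v') *m faug F) 0 0).
      rewrite mulmxBl mxE [X in _ + X]mxE augZ e mulrDr addrC addrA addKr.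
      by apply: BD => //; apply: (BM _ _ Bb').1.
    (* Modulo B the image of v equals x times the image of v', so v - x v' is
       a boundary. *)
    exists (row_mx w v'); rewrite /= mul_row_col -we mul_mx_scalar.
    by rewrite subrK.
  rewrite -[w]hsubmxK /= mul_row_col mul_mx_scalar mulmxDl mxE augZ.
  exists ((rsubmx w *m faug F) 0 0), ((lsubmx w *m fdiff F 0 *m faug F) 0 0).
  by rewrite addrC; split=> //; apply/h1; exists (lsubmx w).
- rewrite -[v]hsubmxK /=; set a := lsubmx _; set b := rsubmx _.
  rewrite mul_row_col mul_mx_scalar; split=> [e|[w]]; last first.
    rewrite -[w]hsubmxK mul_row_block mulmx0 add0r mul_mx_scalar.
    case/eq_row_mx => -> ->; rewrite mulmxDl -mulmxA dd mulmx0 add0r mulmxN.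
    by rewrite scalerN -scalemxAl subrr.
  have /h1[w we] : B ((b *m faug F) 0 0).
    apply: nzd => //; rewrite -augZ; move/eqP: e.
    rewrite addr_eq0 => /eqP/(congr1 (fun M => (M *m faug F) 0 0)).
    rewrite mulNmx [in RHS]mxE => /esym/(congr1 -%R); rewrite opprK => ->.
    by apply: BN; apply/h1; exists a.
  have /h2[w' w'e] : (a + x *: w) *m fdiff F 0 = 0.
    by rewrite mulmxDl -scalemxAl -we.
  exists (row_mx w' (- w)); rewrite mul_row_block mulmx0 add0r mul_mx_scalar.
  by rewrite -w'e scalerN addrK mulNmx mulmxN opprK -we.
- rewrite -[v]hsubmxK /=; set a := lsubmx _; set b := rsubmx _.
  rewrite mul_row_block mul_mx_scalar mulmx0 add0r.
  split=> [|[w]]; last first.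
    rewrite -[w]hsubmxK mul_row_block mulmx0 add0r mul_mx_scalar.
    case/eq_row_mx => -> ->; rewrite mulmxDl -mulmxA dd mulmx0 add0r !mulmxN.
    by rewrite scalerN -scalemxAl subrr mulNmx -mulmxA dd mulmx0 !oppr0 row_mx0.
  rewrite -[0]row_mx0 => /eq_row_mx[e].
  move/eqP; rewrite mulmxN oppr_eq0 => /eqP/h2[w we].
  have /h2[w' w'e] : (a + x *: w) *m fdiff F i.+1 = 0.
    by rewrite mulmxDl -scalemxAl -we.
  exists (row_mx w' (- w)); rewrite mul_row_block mulmx0 add0r mul_mx_scalar.
  by rewrite -w'e scalerN addrK mulNmx mulmxN opprK -we.
Qed.

Lemma card_sumdeg (p q : nat) (ra : 'I_p -> nat) (rb : 'I_q -> nat) j :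
  #|[set a | sumdeg ra rb a == j]| =
  (#|[set a | ra a == j]| + #|[set b | rb b == j]|)%N.
Proof.
rewrite -!sum1_card !(big_mkcond (fun a => a \in _)) big_split_ord /=.
by congr addn; apply: eq_bigr => a _; rewrite !inE ?sumdegl ?sumdegr.
Qed.

Lemma fcount_kcone0 F x j : fcount (kcone F x) 0 j = fcount F 0 j.
Proof. by []. Qed.

Lemma fcount_kconeS F x i j : fcount (kcone F x) i.+1 j =
  (fcount F i.+1 j + #|[set a : 'I_(frank F i) | (fdeg a).+1 == j]|)%N.
Proof. exact: card_sumdeg. Qed.

(** The total complex of a map of degree -1 from G to F, an extension of G by
    F. *)
Definition extension F G (c : forall i, 'M[S]_(frank G i.+1, frank F i)) :=
  @FreeComplex K n (fun i => frank F i + frank G i)%N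
    (fun i => sumdeg (@fdeg _ _ F i) (@fdeg _ _ G i))
    (fun i => block_mx (fdiff F i) 0 (c i) (fdiff G i))
    (col_mx (faug F) (faug G)).

Lemma fcount_extension F G c i j :
  fcount (@extension F G c) i j = (fcount F i j + fcount G i j)%N.
Proof. exact: card_sumdeg. Qed.

(** The connecting maps c are constructed by lifting: c d + d c = 0 has a
    solution in each degree because d c composed with the previous
    differential is zero. Homogeneity of the c i is recorded because
    minimality of the extension will be read off their degrees. *)
Lemma horseshoe F G A B : is_ideal A -> (forall p, B p -> A p) ->
  graded_complex F -> graded_complex G ->
  resolves F B -> resolves_quot G A B ->
  exists c, [/\ graded_complex (@extension F G c),
     forall i, graded_mx (@fdeg _ _ G i.+1) (@fdeg _ _ F i) (c i)
    & resolves (@extension F G c) A].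
Proof.
move=> [A0 AD AM] BA /graded_complexE[aF dF] /graded_complexE[aG dG] rF rG.
have ddG i := quot_fdiff_fdiff i rG.
have [h0 h1 h2] := rG; have [k0 k1 k2] := rF.
have [|N gN NE] := graded_lift (graded_mulmx (dG 0) aG) aF.
  move=> a; have /k0[w we] : B ((fdiff G 0 *m faug G) a 0).
    have := (h1 (row a (fdiff G 0))).2 (ex_intro _ (delta_mx 0 a) (rowE _ _)).
    by rewrite -row_mul mxE.
  by exists w; apply/matrixP => x y; rewrite !ord1 -we mxE.
have [||c [c0 gc cS]] := @dependent_sequence
  (fun i => 'M[S]_(frank G i.+1, frank F i))
  (fun i c => graded_mx (@fdeg _ _ G i.+1) (@fdeg _ _ F i) c /\
     forall a, exists w, row a (fdiff G i.+1 *m c) = w *m fdiff F i)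
  (fun i c c' => c' *m fdiff F i + fdiff G i.+1 *m c = 0) (- N).
- split; first exact: graded_oppmx.
  apply: (exact_rows0 rF).
  by rewrite -mulmxA mulNmx -NE mulmxN mulmxA ddG mul0mx oppr0.
- move=> i c [gc /(graded_lift (graded_mulmx (dG i.+1) gc) (dF i))[c' gc' c'E]].
  exists (- c'); last by rewrite mulNmx -c'E addNr.
  split; first exact: graded_oppmx.
  apply: (exact_rows rF).
  by rewrite -mulmxA mulNmx -c'E mulmxN mulmxA ddG mul0mx oppr0.
(* In the lowest degree, c 0 corrects the relations of A / B, which hold in A
   only modulo B. *)
have cE : c 0 *m faug F + fdiff G 0 *m faug G = 0.
  by rewrite c0 mulNmx -NE addNr.
exists c; split; last split.
- apply/graded_complexE; split; first exact: graded_col_mx.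
  by move=> i; apply: graded_block_mx;
    [apply: dF|apply: graded_mx0|case: (gc i)|apply: dG].
- by move=> i; case: (gc i).
- move=> p; split=> [/h0[v [q [/k0[w ->] ->]]]|[v ->]].
    by exists (row_mx w v); rewrite /= mul_row_col [RHS]mxE addrC.
  rewrite -[v]hsubmxK /= mul_row_col mxE; apply: AD.
    by apply: BA; apply/k0; eexists.
  by apply/h0; exists (rsubmx v), 0; rewrite addr0; split=> //; apply/k0;
    exists 0; rewrite mul0mx mxE.
- move=> v; rewrite -[v]hsubmxK /=; set a := lsubmx _; set b := rsubmx _.
  rewrite mul_row_col; split=> [e|[w]]; last first.
    rewrite -[w]hsubmxK mul_row_block mulmx0 add0r => /eq_row_mx[-> ->].
    by rewrite mulmxDl -!mulmxA (fdiff_aug rF) mulmx0 add0r -mulmxDr cE mulmx0.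
  have /h1[w we] : B ((b *m faug G) 0 0).
    apply/k0; exists (- a); move/eqP: e; rewrite addr_eq0 => /eqP e.
    by rewrite mulNmx e opprK.
  have /k1[w' w'e] : (a - w *m c 0) *m faug F = 0.
    rewrite mulmxBl -mulmxA; move/eqP: cE; rewrite addr_eq0 => /eqP ->.
    by rewrite mulmxN opprK mulmxA -we.
  exists (row_mx w' w); rewrite mul_row_block mulmx0 add0r -we -w'e.
  by rewrite subrK.
- move=> i v; rewrite -[v]hsubmxK /=; set a := lsubmx _; set b := rsubmx _.
  rewrite mul_row_block mulmx0 add0r; split=> [|[w]]; last first.
    rewrite -[w]hsubmxK mul_row_block mulmx0 add0r => /eq_row_mx[-> ->].
    rewrite mulmxDl -!mulmxA (fdiff_fdiff _ rF) mulmx0 add0r -mulmxDr cS mulmx0.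
    by rewrite ddG mulmx0 row_mx0.
  rewrite -[0]row_mx0 => /eq_row_mx[e /h2[w we]].
  have /k2[w' w'e] : (a - w *m c i.+1) *m fdiff F i = 0.
    rewrite mulmxBl -mulmxA; move/eqP: (cS i); rewrite addr_eq0 => /eqP ->.
    by rewrite mulmxN opprK mulmxA -we.
  exists (row_mx w' w); rewrite mul_row_block mulmx0 add0r -we -w'e.
  by rewrite subrK.
Qed.

End Subquotients.

(** * Squarefree monomial ideals and their Koszul resolutions *)

Section SquarefreeIdeals.

Variables (K : fieldType) (n : nat).
Local Notation S := {mpoly K[n]}.
Implicit Types (p q : S) (s t u v w T : {set 'I_n}) (m : 'X_{1..n}).
Implicit Types (N A D : {set {set 'I_n}}).

Definition mnm_supp m : {set 'I_n} := [set i | m i != 0%N].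

Lemma mnm_suppD m1 m2 : mnm_supp (m1 + m2) = mnm_supp m1 :|: mnm_supp m2.
Proof. by apply/setP => i; rewrite !inE mnmDE addn_eq0 negb_and. Qed.

Lemma mnm_suppU i : mnm_supp U_(i)%MM = [set i].
Proof.
by apply/setP => j; rewrite !inE mnm1E [j == i]eq_sym; case: (i == j).
Qed.

Definition set_mnm s : 'X_{1..n} := (\sum_(i in s) U_(i))%MM.

Lemma set_mnmE s i : set_mnm s i = (i \in s).
Proof.
rewrite /set_mnm mnm_sumE; case: (boolP (i \in s)) => si.
  rewrite (bigD1 i) //= mnm1E eqxx big1 // => j /andP[_ /negPf ji].
  by rewrite mnm1E ji.
rewrite big1 // => j js; rewrite mnm1E; case: eqP => // ji.
by move: si; rewrite -ji js.
Qed.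

Lemma mnm_supp_set_mnm s : mnm_supp (set_mnm s) = s.
Proof. by apply/setP => i; rewrite !inE set_mnmE; case: (i \in s). Qed.

Lemma mdeg_set_mnm s : mdeg (set_mnm s) = #|s|.
Proof. by rewrite mdegE -sum1_card [RHS]big_mkcond; apply: eq_bigr => i _;
rewrite set_mnmE; case: (i \in s). Qed.

Lemma xprodE s : xprod K s = 'X_[set_mnm s].
Proof. by rewrite /xprod /set_mnm mprodXE. Qed.

Lemma set_mnm_le s m : (set_mnm s <= m)%MM = (s \subset mnm_supp m).
Proof.
apply/mnm_lepP/subsetP => h i; last first.
  by rewrite set_mnmE; case: (boolP (i \in s)) => // /h; rewrite inE lt0n.
by move=> si; have := h i; rewrite set_mnmE si inE lt0n.
Qed.

Definition upclosed N := forall s t, s \in N -> s \subset t -> t \in N.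

(** When N is closed under supersets this is the squarefree monomial ideal
    whose squarefree monomials are the x_s with s in N: whether x_s divides a
    monomial depends only on the support of that monomial, so membership is a
    condition on supports. *)
Definition sqf_ideal N p := forall m, p@_m != 0 -> mnm_supp m \in N.

Lemma sqf_idealD N p q : sqf_ideal N p -> sqf_ideal N q -> sqf_ideal N (p + q).
Proof.
move=> hp hq m; rewrite mcoeffD; have [p0|/hp //] := eqVneq p@_m 0.
by rewrite p0 add0r => /hq.
Qed.

Lemma sqf_ideal0 N : sqf_ideal N 0.
Proof. by move=> m; rewrite mcoeff0 eqxx. Qed.

Lemma sqf_ideal_is_ideal N : upclosed N -> is_ideal (sqf_ideal N).
Proof.
move=> upN; split=> [|p q|r p hp]; [exact: sqf_ideal0|exact: sqf_idealD|].
by split=> m /mcoeffM_neq0[m1 [m2 [h1 h2 ->]]]; rewrite mnm_suppD;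
  [apply: upN (hp _ h2) _; apply: subsetUr|apply: upN (hp _ h1) _;
    apply: subsetUl].
Qed.

Lemma sqf_idealMl N p q : upclosed N -> sqf_ideal N q -> sqf_ideal N (p * q).
Proof. by case/sqf_ideal_is_ideal => _ _ h /(h p)[]. Qed.

Lemma sqf_ideal_xprod N s : sqf_ideal N (xprod K s) <-> s \in N.
Proof.
rewrite xprodE; split=> [/(_ (set_mnm s))|sN m].
  by rewrite mcoeffX eqxx oner_eq0 mnm_supp_set_mnm; apply.
rewrite mcoeffX; have [<-|] := eqVneq (set_mnm s) m; rewrite ?eqxx //.
by rewrite mnm_supp_set_mnm.
Qed.

Lemma SR_idealE D p : (forall s t, s \in D -> t \subset s -> t \in D) ->
  SR_ideal K D p <-> sqf_ideal (~: D) p.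
Proof.
move=> downD; have upN : upclosed (~: D).
  by move=> s t; rewrite !inE => sN st; apply: contra sN => /downD/(_ st).
split=> [h|h I [I0 ID IM] IX].
  apply: h; first exact: sqf_ideal_is_ideal.
  by move=> _ [s sD ->]; apply/sqf_ideal_xprod; rewrite inE.
rewrite [p]mpolyE big_seq; elim/big_ind: _ => // m.
rewrite mcoeff_msupp => /h; rewrite inE => mD.
have /submK <- : (set_mnm (mnm_supp m) <= m)%MM by rewrite set_mnm_le.
rewrite mpolyXD -xprodE.
rewrite -mul_mpolyC mulrA.
by apply: (IM _ _ _).1; apply: IX; exists (mnm_supp m).
Qed.

Lemma sqf_ideal_split N N1 N2 p : sqf_ideal N p -> N \subset N1 :|: N2 ->
  exists a b, [/\ sqf_ideal N1 a, sqf_ideal N2 b & p = a + b].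
Proof.
move=> hp /subsetP sN.
exists (mfilter (fun m => mnm_supp m \in N1) p),
  (mfilter (fun m => mnm_supp m \notin N1) p).
split=> [m|m|].
- by rewrite mcoeff_mfilter; case: ifP => // _; rewrite eqxx.
- rewrite mcoeff_mfilter; case: ifP => [h /hp/sN|_]; last by rewrite eqxx.
  by rewrite inE (negPf h).
- apply/mpolyP => m; rewrite mcoeffD !mcoeff_mfilter.
  by case: ifP; rewrite ?addr0 ?add0r.
Qed.

Definition upset A : {set {set 'I_n}} :=
  [set w : {set 'I_n} | [exists v in A, v \subset w]].

Lemma upsetP A w : reflect (exists2 v, v \in A & v \subset w) (w \in upset A).
Proof. by rewrite inE; apply: exists_inP. Qed.

Lemma upset_up A : upclosed (upset A).
Proof.
move=> s t /upsetP[v vA vs] st; apply/upsetP; exists v => //.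
exact: subset_trans vs st.
Qed.

Lemma sqf_ideal_divX s p : sqf_ideal (upset [set s]) p ->
  exists q, p = q * 'X_[set_mnm s].
Proof.
move=> hp; exists (\sum_(m <- msupp p) p@_m *: 'X_[m - set_mnm s]).
rewrite {1}[p]mpolyE mulr_suml !big_seq; apply: eq_bigr => m.
rewrite mcoeff_msupp -scalerAl -mpolyXD => /hp/upsetP[_ /set1P ->].
by rewrite -set_mnm_le => /submK ->.
Qed.

(** The resolution 0 -> S(-d) of a principal ideal. *)
Definition rank_one_complex (d : nat) (x : S) : free_complex K n :=
  @FreeComplex K n (fun i => (i == 0)%N : nat) (fun _ _ => d) (fun=> 0)
    (const_mx x).

(** The squarefree monomials of the ideal generated by the x_t x_u with t in
    T, when T is disjoint from u. *)
Definition meeting u T : {set {set 'I_n}} :=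
  [set w : {set 'I_n} | (u \subset w) && ~~ [disjoint w & T]].

Lemma upset1 u w : (w \in upset [set u]) = (u \subset w).
Proof.
by apply/upsetP/idP => [[v /set1P ->]|uw] //; exists u; rewrite ?inE.
Qed.

Lemma meeting_up u T : upclosed (meeting u T).
Proof.
move=> s t; rewrite !inE => /andP[us sT] st; rewrite (subset_trans us st) /=.
by apply: contra sT; apply: disjointWl.
Qed.

Lemma resolves_quot_ext (F : free_complex K n) (A A' B B' : S -> Prop) :
  (forall p, A p <-> A' p) -> (forall p, B p <-> B' p) ->
  resolves_quot F A B -> resolves_quot F A' B'.
Proof.
move=> hA hB [h0 h1 h2]; split=> // [p|v]; last by rewrite -hB.
rewrite -hA h0; split=> -[v [q [Bq ->]]]; exists v, q; split=> //;
exact/hB.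
Qed.

Lemma disjointU1r w i T :
  [disjoint w & i |: T] = (i \notin w) && [disjoint w & T].
Proof.
by rewrite -!setI_eq0 setIUr setU_eq0 !setI_eq0 disjoint_sym disjoints1.
Qed.

(** Koszul complex of the variables in l, built by one cone for each variable:
    x_t is a nonzerodivisor modulo the other variables of l because t is not
    among them. Pascal's rule gives the ranks. *)
Lemma koszul_exists u (l : seq 'I_n) : uniq l ->
    (forall i, i \in l -> i \notin u) ->
  exists F, [/\ graded_complex F, minimal_complex F,
    resolves_quot F (sqf_ideal (upset [set u]))
      (sqf_ideal (meeting u [set i in l]))
    & forall i j, fcount F i j = ('C(size l, i) * (#|u| + i == j)%N)%N].
Proof.
elim: l => [_ _|t l IHl /= /andP[tl ul] hu].
  exists (rank_one_complex #|u| (xprod K u)); split.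
  - apply/graded_complexE; split=> [a b|i a b] m; last first.
      by rewrite /= mxE mcoeff0 eqxx.
    rewrite /= mxE xprodE mcoeffX; have [<-|] := eqVneq (set_mnm u) m;
      rewrite ?eqxx //.
    by rewrite mdeg_set_mnm addn0.
  - by apply/minimal_complexP => i; rewrite /= map_mx0.
  - apply: (@resolves_quot_ext _ (sqf_ideal (upset [set u])) _ (fun p => p = 0))
    => // [p|].
      split=> [->|h]; first exact: sqf_ideal0.
      apply/mpolyP => m; rewrite mcoeff0; apply/eqP; apply: contraT => /h.
      by rewrite !inE -setI_eq0 (_ : [set _ in _] = set0) ?setI0 ?eqxx ?andbF
        //; apply/setP => x; rewrite !inE.
    have augE (v : 'rV[S]_1) :
        (v *m const_mx (xprod K u)) 0 0 = v 0 0 * xprod K u.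
      by rewrite mxE big_ord1 mxE.
    apply/resolves_quot0; split=> /= [p|v|i v].
    + split=> [/sqf_ideal_divX[q ->]|[v ->]].
        by exists (const_mx q); rewrite augE mxE xprodE.
      rewrite augE; apply: sqf_idealMl; first exact: upset_up.
      by apply/sqf_ideal_xprod; rewrite upset1.
    + split=> [/mx11_eq0|[w ->]]; last by rewrite mulmx0 mul0mx.
      rewrite augE => /eqP; rewrite mulf_eq0 => /orP[/eqP h|/eqP h].
        by exists 0; rewrite mulmx0; apply/mx11_eq0.
      have /mpolyP/(_ (set_mnm u)) := h.
      by rewrite xprodE mcoeffX eqxx mcoeff0 => /eqP; rewrite oner_eq0.
    + split=> _; last by rewrite mulmx0.
      by exists 0; apply/matrixP => ? [].
  - move=> [|i] j; rewrite /fcount /=.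
      rewrite addn0 mul1n; case: eqP => _.
        rewrite (_ : [set _ | _] = setT); first by rewrite cardsT card_ord.
        by apply/setP => a; rewrite !inE.
      by apply: eq_card0 => a; rewrite !inE.
    by rewrite bin0n /= mul0n; apply: eq_card0 => -[].
have [|F [gF mF rF cF]] := IHl ul.
  by move=> i il; apply: hu; rewrite inE il orbT.
have tu : t \notin u by apply: hu; rewrite inE eqxx.
exists (kcone F 'X_t); split; [exact: kcone_graded|exact: kcone_minimal| |].
- have nzd p : sqf_ideal (upset [set u]) p ->
  sqf_ideal (meeting u [set i in l]) ('X_t * p) ->
      sqf_ideal (meeting u [set i in l]) p.
    move=> hp hxp m pm; have := hxp (U_(t) + m)%MM;
      rewrite mulrC mcoeffMX => /(_ pm).
    have := hp m pm; rewrite upset1 !inE => -> /=.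
    rewrite mnm_suppD mnm_suppU => /andP[_]; apply: contra => dml.
    by rewrite disjoint_sym disjointU1r inE tl disjoint_sym.
  have := kcone_resolves (sqf_ideal_is_ideal (@meeting_up _ _))
    (sqf_ideal_is_ideal (@upset_up _)) nzd rF.
  apply: resolves_quot_ext => // p.
  have setE : [set i in t :: l] = t |: [set i in l] by apply/setP => i;
    rewrite !inE.
  split=> [[a [b [ha hb ->]]]|hp].
    apply: sqf_idealD => m.
      rewrite mulrC; move=> /mcoeffM_neq0[m1 [m2 [/ha]]].
      rewrite upset1 => um1; rewrite mcoeffX;
        have [<- _ ->|] := eqVneq U_(t)%MM m2; rewrite ?eqxx //.
      rewrite inE mnm_suppD mnm_suppU setE disjointU1r !inE eqxx orbT /= andbT.
      exact: subset_trans um1 (subsetUl _ _).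
    by move=> /hb; rewrite !inE setE disjointU1r negb_and => /andP[-> ->];
      rewrite orbT.
  have [|a [b [ha hb ->]]] := @sqf_ideal_split _ (upset [set t |: u])
    (meeting u [set i in l]) _ hp.
    apply/subsetP => w; rewrite in_setU upset1 ![w \in meeting _ _]in_set setE.
    rewrite disjointU1r negb_and negbK subUset sub1set => /andP[-> /=].
    by rewrite andbT.
  have [q ->] := sqf_ideal_divX ha.
  exists (q * 'X_[set_mnm u]), b; split=> //.
    apply: sqf_idealMl; first exact: upset_up.
    by rewrite -xprodE; apply/sqf_ideal_xprod; rewrite upset1.
  by rewrite /set_mnm big_setU1 //= mpolyXD mulrCA.
- move=> [|i] j; first by rewrite fcount_kcone0 cF !bin0.
  rewrite fcount_kconeS cF; case: j => [|j].
    rewrite (_ : [set _ | _] = set0) ?cards0; last by apply/setP => a;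
      rewrite !inE.
    by rewrite addnS !muln0.
  rewrite -[X in (_ + X)%N]/(fcount F i j) cF /= binS mulnDl addnS eqSS.
  by [].
Qed.

End SquarefreeIdeals.

(** * Squarefree stable families have linear quotients *)

Section StableFamilies.

Variable n : nat.
Implicit Types (s t u v w T : {set 'I_n}) (N A D : {set {set 'I_n}}).

(** Set form of squarefree stability, for the family of supports of the
    squarefree monomials of an ideal. *)
Definition stable_family N := forall s (m i : 'I_n), s \in N -> m \in s ->
  (forall k, k \in s -> (k <= m)%N) -> (i < m)%N -> i \notin s ->
  i |: (s :\ m) \in N.

(** The number m(u) of the monomial u = x_s, in the 1-based numbering of the
    variables; 0 for the empty set. Thus s lies in the first k indices if and
    only if [max_index s <= k]. *)
Definition max_index s : nat := \max_(i in s) i.+1.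

Lemma max_index_leE s k : (max_index s <= k)%N = [forall i in s, (i < k)%N].
Proof. by apply/bigmax_leqP/forall_inP. Qed.

Lemma ltn_max_index s (i : 'I_n) : i \in s -> (i < max_index s)%N.
Proof. by move=> si; rewrite (leq_bigmax_cond (F := fun i : 'I_n => i.+1)). Qed.

Lemma max_index_leP s k : reflect (forall i : 'I_n, i \in s -> (i < k)%N)
    (max_index s <= k)%N.
Proof. exact: bigmax_leqP. Qed.

Lemma max_index_le_n s : (max_index s <= n)%N.
Proof. by apply/max_index_leP => i _. Qed.

Lemma max_index_attained s : s != set0 ->
  exists2 m : 'I_n, m \in s & max_index s = m.+1.
Proof.
case/set0Pn => i si.
have [|m sm e] := @eq_bigmax_cond _ (mem s) (fun i : 'I_n => i.+1).
  by apply/card_gt0P; exists i.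
by exists m.
Qed.

Lemma max_index_setU1 s (k : 'I_n) : (max_index s <= k)%N ->
    max_index (k |: s) = k.+1.
Proof.
move=> h; apply/eqP; rewrite eqn_leq ltn_max_index ?setU11 // andbT.
apply/max_index_leP => i /setU1P[->//|/ltn_max_index]; lia.
Qed.

Definition gens N := [set s in N | [forall t in N, (t \subset s) ==> (t == s)]].

Lemma gensP N s : reflect (s \in N /\ forall t, t \in N -> t \subset s -> t = s)
  (s \in gens N).
Proof.
rewrite inE; apply: (iffP andP) => -[sN h]; split=> //.
  by move=> t tN ts; apply/eqP; move/forall_inP/(_ t tN): h; rewrite ts.
by apply/forall_inP => t tN; apply/implyP => ts; apply/eqP/h.
Qed.

Lemma gens_sub N s : s \in N -> exists2 t, t \in gens N & t \subset s.
Proof.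
move=> sN; have [t /minsetP[tN tmin] ts] := @minset_exists _ (mem N) s sN.
by exists t => //; apply/gensP; split.
Qed.

Lemma upset_gens N : upclosed N -> upset (gens N) = N.
Proof.
move=> upN; apply/setP => w; apply/upsetP/idP => [[v /gensP[vN _]]|/gens_sub//].
exact: upN.
Qed.

(** The variables that generate the colon ideal of u by the generators
    preceding it, see [linear_quotients]. *)
Definition holes u := [set i : 'I_n | (i < max_index u)%N && (i \notin u)].

Lemma card_holes u : #|holes u| = (max_index u - #|u|)%N.
Proof.
have -> : holes u = [set i : 'I_n | (i < max_index u)%N] :\: u.
  by apply/setP => i; rewrite !inE andbC.
rewrite cardsD (setIidPr _); last by apply/subsetP => i /ltn_max_index;
  rewrite inE.
by rewrite -sum1dep_card big_ord_narrow ?max_index_le_n // sum_nat_const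
  card_ord muln1.
Qed.

(** Stability replaces the largest element of v, which lies beyond u, by any
    smaller one, in particular by an element of u not yet in v; there are
    enough of these because v has no more elements than u. *)
Lemma exchange N u v : stable_family N -> v \in N ->
  (forall i, i \in v :\: u -> (max_index u <= i)%N) -> (#|v| <= #|u|)%N ->
  exists v', [/\ v' \in N, v' \subset u & #|v'| = #|v|].
Proof.
move=> stN; move: {2}_.+1 (ltnSn #|v :\: u|) => k.
elim: k v => // k IHk v hk vN hv cvu.
have [vu|] := boolP (v \subset u); first by exists v.
rewrite -setD_eq0 => vu0; have vu := hv.
have [j jvu] := set0Pn _ vu0.
have [|m vm em] := @max_index_attained v; first by apply/set0Pn; exists j;
  case/setDP: jvu.
have mmax i : i \in v -> (i <= m)%N by move=> /ltn_max_index; rewrite em.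
have mum : (max_index u <= m)%N.
  by apply: leq_trans (hv _ jvu) _; apply: mmax; case/setDP: jvu.
have mu : m \notin u by apply: contraTN mum => /ltn_max_index; rewrite ltnNge.
have mvu : m \in v :\: u by rewrite inE mu.
have cuv : (#|v :\: u| <= #|u :\: v|)%N.
  by rewrite !cardsD setIC; apply: leq_sub2r.
have [i iuv] : exists i, i \in u :\: v.
  by apply/card_gt0P; apply: leq_trans cuv; rewrite card_gt0.
have [iu iv] := setDP iuv.
have im : (i < m)%N by apply: leq_trans (ltn_max_index iu) mum.
have ivm : i \notin v :\ m by rewrite !inE negb_and iv orbT.
have cv1 : #|i |: (v :\ m)| = #|v|
  by rewrite cardsU1 ivm [in RHS](cardsD1 m) vm.
have v1u : (i |: (v :\ m)) :\: u = (v :\: u) :\ m.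
  apply/setP => x; rewrite !inE; case: eqVneq => [->|];
    last by rewrite /= andbCA.
  by rewrite iu /= andbF.
have [||||v' [v'N v'u cv']] := IHk (i |: (v :\ m)).
- by rewrite v1u; move: hk; rewrite (cardsD1 m) mvu.
- exact: stN.
- by move=> x; rewrite v1u => /setD1P[_]; apply: hv.
- by rewrite cv1.
by exists v'; rewrite -cv1.
Qed.

(** Lexicographic order by degree and then by m(u): the factor n + 1 exceeds
    every value of m(u). *)
Definition key u := (#|u| * n.+1 + max_index u)%N.

Lemma key_le u v : (key v <= key u)%N ->
  (#|v| < #|u|)%N \/ #|v| = #|u| /\ (max_index v <= max_index u)%N.
Proof.
rewrite /key; have := max_index_le_n u; have := max_index_le_n v.
by case: (ltngtP #|v| #|u|) => [||->]; nia.
Qed.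

Lemma key_lt u v :
  (#|v| < #|u|)%N \/ #|v| = #|u| /\ (max_index v < max_index u)%N ->
  (key v < key u)%N.
Proof.
by rewrite /key; have := max_index_le_n v => ? [|[->]]; nia.
Qed.

(** In monomial terms: (A) : u is generated by the x_t with t in [holes u],
    when A consists of the generators that precede u, generators with the same
    key being in any order. If t is a hole, stability gives x_t u / x_m in the
    ideal, and a generator dividing it precedes u. Conversely, let an earlier v
    divide a multiple of u free of holes, so that v lies in u up to elements
    beyond m(u). Exchanging those produces a member of the family inside u with
    as many elements as v; as u is minimal, v has as many elements as u. Then
    m(v) is at most m(u), so v has no element beyond m(u) and is equal to u. *)
Lemma linear_quotients N A u w : upclosed N -> stable_family N ->
  u \in gens N -> A \subset gens N -> u \notin A ->
  (forall v, v \in A -> (key v <= key u)%N) ->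
  (forall v, v \in gens N -> (key v < key u)%N -> v \in A) ->
  u \subset w -> (w \in upset A) = ~~ [disjoint w & holes u].
Proof.
move=> upN stN /gensP[uN umin] Agens uA Ale Alt uw.
apply/idP/idP => [/upsetP[v vA vw]|].
  apply/negP => dw.
  have hv i : i \in v :\: u -> (max_index u <= i)%N.
    case/setDP => iv iu; rewrite leqNgt; apply/negP => im.
    by have := disjointFr dw (subsetP vw _ iv); rewrite inE im iu.
  have /gensP[vN _] := subsetP Agens _ vA.
  have cvu : (#|v| <= #|u|)%N by have /key_le[/ltnW|[->]] := Ale _ vA.
  have [v' [v'N v'u cv']] := exchange stN vN hv cvu.
  have e := umin _ v'N v'u; rewrite e in cv'.
  have [|[_ mvu]] := key_le (Ale _ vA); first by rewrite cv' ltnn.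
  have vu : v \subset u.
    apply/subsetP => i iv; apply: contraT => iu.
    have := hv i; rewrite inE iu iv => /(_ isT).
    by rewrite leqNgt (leq_trans (ltn_max_index iv) mvu).
  have /eqP vE : v == u by rewrite eqEcard vu cv' leqnn.
  by move: uA; rewrite -vE vA.
rewrite -setI_eq0 => /set0Pn[t /setIP[tw]]; rewrite inE => /andP[tmx tu].
have [|m um em] := @max_index_attained u.
  apply: contraTneq tmx => ->; rewrite -leqNgt; apply: leq_trans (leq0n _).
  by apply/max_index_leP => i; rewrite inE.
have mmax i : i \in u -> (i <= m)%N by move=> /ltn_max_index; rewrite em.
(* The hole t replaces the largest element m of u. *)
have tm : (t < m)%N.
  move: tmx; rewrite em ltnS leq_eqVlt => /orP[/eqP/val_inj e|//].
  by rewrite e um in tu.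
have sN := stN u m t uN um mmax tm tu; set s := t |: _ in sN.
have cs : #|s| = #|u|.
  by rewrite /s cardsU1 !inE negb_and tu orbT [in RHS](cardsD1 m) um.
have sw : s \subset w.
  rewrite subUset sub1set tw; apply: subset_trans uw.
  exact: subsetDl.
have ms : (max_index s < max_index u)%N.
  rewrite em ltnS; apply/max_index_leP => i /setU1P[->//|/setD1P[im /mmax]].
  by rewrite leq_eqVlt => /orP[/eqP/val_inj e|//]; rewrite e eqxx in im.
have [v vg vs] := gens_sub sN.
apply/upsetP; exists v; last exact: subset_trans sw.
apply: Alt => //; apply: key_lt.
have := subset_leq_card vs; rewrite leq_eqVlt cs => /orP[/eqP cv|];
  [right|by left].
have /eqP -> : v == s by rewrite eqEcard vs cs cv leqnn.
by [].
Qed.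

End StableFamilies.

(** * The minimal resolution of a squarefree stable ideal *)

Section Existence.

Variables (K : fieldType) (n : nat).
Local Notation S := {mpoly K[n]}.
Implicit Types (s t u v w T : {set 'I_n}) (N A D : {set {set 'I_n}}).

(** Second isomorphism theorem: (A0 + B) / B is A0 / B0 when B0 is the
    intersection of A0 and B. *)
Lemma resolves_quot_iso (F : free_complex K n) (A B A0 B0 : S -> Prop) :
  is_ideal B ->
  (forall p, A p <-> exists a b, [/\ A0 a, B b & p = a + b]) ->
  (forall p, A0 p -> (B p <-> B0 p)) ->
  resolves_quot F A0 B0 -> resolves_quot F A B.
Proof.
move=> [Bz BD _] hA hB [h0 h1 h2].
have A0aug (v : 'rV_(frank F 0)) : B0 0 -> A0 ((v *m faug F) 0 0).
  by move=> B00; apply/h0; exists v, 0; rewrite addr0.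
have B00 : B0 0 by have [_] := h1 0; rewrite mul0mx mxE; apply; exists 0;
  rewrite mul0mx.
split=> // [p|v]; last by rewrite -h1; apply: hB; apply: A0aug.
rewrite hA; split=> [[a [b [/h0[v [q [Bq ->]]] Bb ->]]]|[v [q [Bq ->]]]].
  exists v, (q + b); rewrite addrA; split=> //; apply: BD => //.
  apply/hB => //; apply/h0; exists 0, q; rewrite mul0mx mxE add0r; by split.
by exists ((v *m faug F) 0 0), q; split=> //; apply: A0aug.
Qed.

(** The Eliahou-Kervaire formula in its squarefree version: a generator u of
    degree d contributes binomial(m(u) - d, i) to the Betti number of index i
    and degree d + i. *)
Definition ek_count A i j :=
  (\sum_(v in A) 'C(#|holes v|, i) * (#|v| + i == j))%N.

Lemma fcount_deg (F : free_complex K n) i (a : 'I_(frank F i)) :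
  (0 < fcount F i (fdeg a))%N.
Proof. by apply/card_gt0P; exists a; rewrite inE. Qed.

(** Induction on an initial segment A of the generators for the order by
    [key]. Removing the last generator u, the quotient of the two ideals is S
    / (x_t, t a hole of u) shifted by the degree of u, resolved by a Koszul
    complex, and the horseshoe lemma adds it to the resolution of the smaller
    ideal. *)
Lemma resolution_exists N A : upclosed N -> stable_family N ->
  A \subset gens N ->
  (forall u v, u \in A -> v \in gens N -> (key v < key u)%N -> v \in A) ->
  exists F, minimal_graded_free_resolution (sqf_ideal (K := K) (upset A)) F /\
    forall i j, fcount F i j = ek_count A i j.
Proof.
move=> upN stN; move: {2}#|A| (erefl #|A|) => k.
elim: k A => [|k IHk] A cA Agens low.
  have A0 : A = set0 by apply/eqP; rewrite -cards_eq0 cA.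
  exists (zero_complex K n); split; last first.
    by move=> i j; rewrite /ek_count A0 big_set0; apply: eq_card0 => -[].
  split.
  - by split=> [|i] [].
  - have v0 (v : 'rV[S]_0) : v = 0 by apply/matrixP => ? [].
    split=> /= [p|v|i v]; last 2 first.
    + by split=> _; [exists 0|]; rewrite [v]v0 !(mul0mx, mulmx0).
    + by split=> _; [exists 0|]; rewrite [v]v0 !(mul0mx, mulmx0).
    split=> [h|[v ->]]; last by rewrite mulmx0 mxE; apply: sqf_ideal0.
    exists 0; rewrite mulmx0 mxE; apply/mpolyP => m; rewrite mcoeff0; apply/eqP.
    apply: contraT => /h/upsetP[v]; by rewrite A0 inE.
  - by move=> i [].
have [u0 u0A] : exists u, u \in A by apply/card_gt0P; rewrite cA.
have [u uA umax] : exists2 u, u \in A & forall v, v \in A -> (key v <= key u)%N.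
  by have [u uA umax] := arg_maxnP (@key n) u0A; exists u.
have cAu : #|A :\ u| = k by move: cA; rewrite (cardsD1 u) uA => -[].
have [||F [[gF rF mF] cF]] := IHk _ cAu.
- exact: subset_trans (subsetDl _ _) Agens.
- move=> u' v /setD1P[u'u u'A] vg lt; rewrite !inE (low u') // andbT.
  by apply: contraTneq lt => ->; rewrite -leqNgt; apply: umax.
have [||G [gG mG rG cG]] := @koszul_exists K n u (enum (holes u)).
- exact: enum_uniq.
- by move=> i; rewrite mem_enum inE => /andP[].
have lin w : u \subset w -> (w \in upset (A :\ u)) = ~~ [disjoint w & holes u].
  apply: (linear_quotients upN stN); [exact: (subsetP Agens)| | | |].
  - exact: subset_trans (subsetDl _ _) Agens.
  - by rewrite !inE eqxx.
  - by move=> v /setD1P[_ /umax].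
  - move=> v vg lt; rewrite !inE (low u) // andbT.
    by apply: contraTneq lt => ->; rewrite ltnn.
have upA : upset A = upset [set u] :|: upset (A :\ u).
  apply/setP => w; rewrite in_setU upset1;
    apply/upsetP/orP => [[v vA vw]|[uw|/upsetP[v /setD1P[_ vA] vw]]].
  - have [<-|vu] := eqVneq v u; [by left|right].
    by apply/upsetP; exists v; rewrite // !inE vu.
  - by exists u.
  - by exists v.
have {}rG : resolves_quot G (sqf_ideal (upset A)) (sqf_ideal (upset (A :\ u))).
  apply: resolves_quot_iso rG; first by apply: sqf_ideal_is_ideal;
    apply: upset_up.
    move=> p; split=> [hp|[a [b [ha hb ->]]]].
      by apply: sqf_ideal_split hp _; rewrite upA.
    by apply: sqf_idealD => [m /ha|m /hb] hm; rewrite upA in_setU hm ?orbT.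
  move=> p hp; split=> h m pm; move: (hp m pm) (h m pm); rewrite upset1 => um.
    by rewrite lin // /meeting inE um => hd;
      rewrite (_ : [set i in _] = holes u) //; apply/setP => i;
        rewrite inE mem_enum.
  rewrite lin // /meeting inE um (_ : [set i in _] = holes u) //.
  by apply/setP => i; rewrite inE mem_enum.
have BA p : sqf_ideal (upset (A :\ u)) p -> sqf_ideal (K := K) (upset A) p.
  by move=> hp m /hp; rewrite upA in_setU => ->; rewrite orbT.
have upA_ideal : is_ideal (sqf_ideal (K := K) (upset A)).
  by apply: sqf_ideal_is_ideal; apply: upset_up.
have [c [gH gc rH]] := horseshoe upA_ideal BA gF gG rF rG.
exists (extension c); split; last first.
  move=> i j; rewrite fcount_extension cF cG /ek_count [in RHS](big_setD1 u)
    //=.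
  by rewrite -cardE addnC.
split=> //; apply/minimal_complexP => i /=.
move/minimal_complexP: mF => mF; move/minimal_complexP: mG => mG.
rewrite map_block_mx mF mG map_mx0.
(* The connecting map goes from generators of degree #|u| + i + 1 to
   generators of degree at most #|u| + i, the degree of u being the largest:
   its entries are homogeneous of positive degree. *)
suff -> : map_mx (mcoeff 0%MM) (c i) = 0 by rewrite block_mx0.
apply/matrixP => a b; rewrite !mxE; apply/eqP; apply: contraT => /gc.
rewrite mdeg0 add0n => e.
have := fcount_deg a; rewrite cG lt0n muln_eq0 negb_or eqb0 negbK =>
  /andP[_ /eqP ea].
have := fcount_deg b; rewrite cF lt0n /ek_count sum_nat_eq0 negb_forall.
case/existsP => v; rewrite negb_imply muln_eq0 negb_or eqb0 negbK.
case/andP => /setD1P[_ vA] /andP[_ /eqP eb].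
have /key_le := umax v vA; rewrite e -ea in eb; lia.
Qed.

Lemma graded_betti_stable D i j :
  (forall s t, s \in D -> t \subset s -> t \in D) -> stable_family (~: D) ->
  graded_betti (SR_ideal K D) i j = ek_count (gens (~: D)) i j.
Proof.
move=> downD stD.
have upD : upclosed (~: D).
  by move=> s t; rewrite !inE => sN st; apply: contra sN => /downD/(_ st).
have [F [[gF rF mF] cF]] := resolution_exists upD stD (subxx _)
  (fun u v _ h _ => h).
rewrite upset_gens // in rF.
rewrite -cF; apply: graded_bettiE; split=> //.
case: rF => h0 h1 h2; split=> // p; rewrite -h0; exact: SR_idealE.
Qed.

End Existence.

(** * Counting generators of a stable family *)

Section Counting.

Variable n : nat.
Implicit Types (s t u v w T : {set 'I_n}) (N A D : {set {set 'I_n}}).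

(** The squarefree monomials of degree j in the first k variables that lie in
    the ideal. These numbers determine the Betti numbers, and they are what a
    generic change of coordinates preserves. *)
Definition segment_count N j k :=
  #|[set s in N | (#|s| == j) && (max_index s <= k)%N]|.

Lemma sum_by_max_index N (f : nat -> nat -> nat) :
  (\sum_(s in N) f #|s| (max_index s) = \sum_(j < n.+1) \sum_(k < n.+1)
    #|[set s in N | (#|s| == j) && (max_index s == k)]| * f j k)%N.
Proof.
rewrite (partition_big (fun s => inord #|s| : 'I_n.+1) predT) //=.
apply: eq_bigr => j _.
rewrite (partition_big (fun s => inord (max_index s) : 'I_n.+1) predT) //=.
apply: eq_bigr => k _.
rewrite -sum1_card big_distrl /=.
apply: congr_big => // [s|s].
  rewrite !inE -andbA -!val_eqE /= !inordK // ltnS ?max_index_le_n //.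
  by have := max_card (mem s); rewrite card_ord.
rewrite mul1n => /andP[/andP[_ /eqP <-] /eqP <-].
rewrite !inordK // ltnS ?max_index_le_n //.
by have := max_card (mem s); rewrite card_ord.
Qed.

Lemma segment_count0 N j :
  segment_count N j 0 = #|[set s in N | (#|s| == j) && (max_index s == 0%N)]|.
Proof. by apply: eq_card => s; rewrite !inE leqn0. Qed.

Lemma segment_countS N j k : segment_count N j k.+1 =
  (segment_count N j k +
    #|[set s in N | (#|s| == j) && (max_index s == k.+1)]|)%N.
Proof.
rewrite -cardsUI [X in (_ + X)%N](_ : _ = 0%N) ?addn0.
  apply: eq_card => s; rewrite !inE -!andb_orr; congr [&& _, _ & _].
  lia.
by apply: eq_card0 => s; rewrite !inE;
  apply/negP => /andP[/and3P[_ _ h] /and3P[_ _ /eqP e]]; lia.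
Qed.

Lemma sum_max_index_eq N N' (f : nat -> nat -> nat) :
  (forall j k, segment_count N j k = segment_count N' j k) ->
  (\sum_(s in N) f #|s| (max_index s) = \sum_(s in N') f #|s| (max_index s))%N.
Proof.
move=> h; rewrite !sum_by_max_index; apply: eq_bigr => j _;
  apply: eq_bigr => k _.
congr (_ * _)%N; case: k => -[|k] /= _.
  by have := h j 0%N; rewrite !segment_count0.
by have := h j k.+1; rewrite !segment_countS h => /addnI.
Qed.

(** A member s of the family fails to be a minimal generator exactly when s
    without its largest element is already in the family: if some s minus a is
    in the family, stability moves the largest element of s to a. So the
    non-generators are the sets k |: t with t in the family and k beyond t,
    each obtained once. *)
Lemma sum_gens_add N (f : nat -> nat -> nat) : upclosed N -> stable_family N ->
  (\sum_(s in N) f #|s| (max_index s) =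
   \sum_(s in gens N) f #|s| (max_index s) +
   \sum_(t in N) \sum_(k < n | (max_index t <= k)%N) f #|t|.+1 k.+1)%N.
Proof.
move=> upN stN; rewrite (big_setID (gens N)) /= (setIidPr _); last first.
  by apply/subsetP => s /gensP[].
congr addn.
pose P := [set x : {set 'I_n} * 'I_n | (x.1 \in N) && (max_index x.1 <= x.2)%N].
pose h (x : {set 'I_n} * 'I_n) := x.2 |: x.1.
have xnot x : x \in P -> x.2 \notin x.1.
  rewrite inE => /andP[_ hx]; apply: contraTN hx => /ltn_max_index;
    by rewrite ltnNge.
have hinj : {in P &, injective h}.
  move=> [t k] [t' k'] hP hP' e.
  have kk : k = k'.
    apply/val_inj; have := congr1 (@max_index n) e;
      rewrite /h !max_index_setU1 /=; first by case.
      by move: hP'; rewrite inE => /andP[].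
    by move: hP; rewrite inE => /andP[].
  move: hP hP' e; rewrite -kk => /xnot /= kt /xnot /= kt' e; congr pair.
  by rewrite -(setU1K kt) -(setU1K kt'); congr (_ :\ _).
have -> : N :\: gens N = h @: P.
  apply/setP => s; rewrite inE; apply/andP/imsetP => [[sg sN]|[[t k] tP ->]].
    have [r [rN rs ne]] : exists r, [/\ r \in N, r \subset s & r != s].
      move: sg; rewrite inE sN /= negb_forall => /existsP[r].
      by rewrite negb_imply => /andP[rN]; rewrite negb_imply => /andP[rs ne];
        exists r.
    have [a as_ ar] : exists2 a, a \in s & a \notin r.
      by apply/subsetPn; move: ne; rewrite eqEsubset rs.
    have [|m sm em] := @max_index_attained _ s; first by apply/set0Pn; exists a.
    have smax k : k \in s -> (k <= m)%N by move=> /ltn_max_index; rewrite em.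
    have sa : s :\ a \in N by apply: upN rN _; rewrite subsetD1 rs ar.
    exists (s :\ m, m); last by rewrite /h setD1K.
    rewrite inE /=; apply/andP; split; last first.
      apply/max_index_leP => i /setD1P[im /smax].
      by rewrite leq_eqVlt => /orP[/eqP/val_inj e|//]; rewrite e eqxx in im.
    have [<- //|am] := eqVneq a m.
    have := stN (s :\ a) m a sa; rewrite !inE eq_sym am sm => /(_ isT).
    have -> : a |: ((s :\ a) :\ m) = s :\ m.
      apply/setP => x; rewrite !inE; case: (eqVneq x a) => [->|] //=.
      by rewrite am as_.
    apply=> [k||]; first by rewrite !inE => /andP[_ /smax].
      by rewrite ltn_neqAle smax // andbT; apply: contra am => /eqP/val_inj ->.
    by rewrite eqxx.
  have kt := xnot _ tP; move: tP; rewrite inE /= => /andP[tN tk].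
  rewrite /h /=; split; last exact: upN (subsetUr _ _).
  apply/negP => /gensP[_ /(_ t tN (subsetUr _ _)) e].
  by move: kt; rewrite /= e setU11.
rewrite big_imset //= pair_big_dep /=.
apply: congr_big => // [[t k]|[t k]] /=; rewrite inE //= => hP.
have kt := xnot (t, k); rewrite inE /= hP in kt.
by rewrite /h /= cardsU1 (kt isT) max_index_setU1 //; case/andP: hP.
Qed.

(** By [card_holes] the summand depends on #|u| and m(u) only, and by
    [sum_gens_add] the sum over the generators is the difference of two sums
    over the whole family of functions of these two numbers. *)
Lemma ek_count_eq N N' i j : upclosed N -> stable_family N ->
  upclosed N' -> stable_family N' ->
  (forall j k, segment_count N j k = segment_count N' j k) ->
  ek_count (gens N) i j = ek_count (gens N') i j.
Proof.
move=> upN stN upN' stN' h.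
pose f a k := ('C(k - a, i) * (a + i == j))%N.
pose g a m := (\sum_(k < n | (m <= k)%N) f a.+1 k.+1)%N.
have E X : ek_count (gens X) i j = (\sum_(s in gens X) f #|s| (max_index s))%N.
  by apply: eq_bigr => s _; rewrite card_holes.
rewrite !E; apply: (@addIn (\sum_(t in N) g #|t| (max_index t))%N).
by rewrite -(sum_gens_add f upN stN) (sum_max_index_eq g h)
  -(sum_gens_add f upN' stN'); apply: sum_max_index_eq.
Qed.

End Counting.

(** * The reverse lexicographic order on subsets *)

Section Revlex.

Variable n : nat.
Implicit Types (s t u A B : {set 'I_n}).

Lemma revlexP s t : reflect ((#|s| < #|t|)%N \/ #|s| = #|t| /\
    exists i : 'I_n, [/\ i \in s, i \notin t &
      forall j : 'I_n, (i < j)%N -> (j \in s) = (j \in t)])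
  (revlex_lt s t).
Proof.
apply: (iffP orP) => -[lt|]; [by left| |by left|].
  case/andP => /eqP e /exists_inP[i]; rewrite inE => /andP[it is_] /forallP h.
  right; split=> //; exists i; split=> // j ij; apply/eqP.
  by have /implyP := h j; apply.
case=> e [i [is_ it h]]; right; rewrite e eqxx; apply/exists_inP; exists i.
  by rewrite inE it.
by apply/forallP => j; apply/implyP => /h ->.
Qed.

Lemma revlex_irr s : revlex_lt s s = false.
Proof. by apply/negP => /revlexP[|[_ [i [->]]]]; rewrite ?ltnn. Qed.

Lemma revlex_trans t s u : revlex_lt s t -> revlex_lt t u -> revlex_lt s u.
Proof.
move=> /revlexP[st|[st [i [is_ it hi]]]] /revlexP[tu|[tu [j [jt ju hj]]]];
  apply/revlexP; try (left; lia).
right; split; first by rewrite st.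
case: (ltngtP i j) => [ij|ji|/val_inj ij].
- exists j; split=> // [|k jk]; first by rewrite hi.
  by rewrite hi ?hj // (ltn_trans ij jk).
- exists i; split=> // [|k ik]; first by rewrite -hj.
  by rewrite hi ?hj // (ltn_trans ji ik).
- by rewrite ij jt in it.
Qed.

Lemma revlex_total s t : s != t -> revlex_lt s t \/ revlex_lt t s.
Proof.
move=> st; case: (ltngtP #|s| #|t|) => [lt|lt|e].
- by left; apply/revlexP; left.
- by right; apply/revlexP; left.
have [i0 i0P] : exists i, (i \in s) != (i \in t).
  apply/existsP; apply: contraNT st => /existsPn h; apply/eqP/setP => i.
  by apply/eqP; have := h i; rewrite negbK.
have [i iP imax] := @arg_maxnP _ i0 (fun i => (i \in s) != (i \in t))
  (fun i : 'I_n => i : nat) i0P.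
have above (j : 'I_n) : (i < j)%N -> (j \in s) = (j \in t).
  by move=> ij; apply/eqP; apply: contraTT ij => /imax; rewrite -leqNgt.
move: iP; case is_: (i \in s); case it: (i \in t) => //= _.
- by left; apply/revlexP; right; split=> //; exists i; split; rewrite ?it.
- right; apply/revlexP; right; split=> //; exists i; split; rewrite ?is_ //.
  by move=> j /above.
Qed.

Lemma revlex_asym s t : revlex_lt s t -> revlex_lt t s -> False.
Proof. by move=> h /(revlex_trans h); rewrite revlex_irr. Qed.

(** Multiplication by e_B preserves the order, as long as it does not kill the
    monomials. *)
Lemma revlex_setU B s t : B \subset t -> [disjoint B & s] ->
  revlex_lt (t :\: B) s -> revlex_lt t (B :|: s).
Proof.
move=> Bt dBs lt.
have ct : #|t| = (#|B| + #|t :\: B|)%N by rewrite -(cardsID B t) (setIidPr Bt).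
have cs : #|B :|: s| = (#|B| + #|s|)%N.
  by rewrite cardsU (_ : B :&: s = set0) ?cards0 ?subn0 //; apply/eqP;
    rewrite setI_eq0.
apply/revlexP; rewrite ct cs; case/revlexP: lt => [lt|[-> [i [itB is_ h]]]].
  by left; rewrite ltn_add2l.
right; split=> //; exists i; move: itB; rewrite !inE => /andP[iB it].
split=> // [|j /h]; first by rewrite negb_or iB.
by rewrite !inE; case: (boolP (j \in B)) => //= jB _; rewrite (subsetP Bt).
Qed.

Lemma card_swap s (m i : 'I_n) : m \in s -> i \notin s -> #|i |: (s :\ m)|
    = #|s|.
Proof.
by move=> ms is_; rewrite cardsU1 !inE negb_and is_ orbT [in RHS](cardsD1 m) ms.
Qed.

(** Only the indices m and i change, in the same way in both sets, so the
    largest difference is unaffected. *)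
Lemma revlex_swap s t (m i : 'I_n) : m \in s -> i \notin s -> m \in t ->
  i \notin t -> revlex_lt s t -> revlex_lt (i |: (s :\ m)) (i |: (t :\ m)).
Proof.
move=> ms is_ mt it /revlexP lt; apply/revlexP; rewrite !card_swap //.
case: lt => [|[e [j [js jt h]]]]; [by left|right; split=> //].
exists j; rewrite !inE js (negPf jt) andbF orbF andbT.
have -> : j != i by apply: contraTneq js => ->.
have -> : j != m by apply: contraNneq jt => ->.
by split=> // [|k /h]; rewrite ?orbT // !inE => ->.
Qed.

Lemma revlex_lt_swap s (m i : 'I_n) : m \in s -> i \notin s -> (i < m)%N ->
  revlex_lt s (i |: (s :\ m)).
Proof.
move=> ms is_ im; apply/revlexP; right; rewrite card_swap //; split=> //.
have nim : m != i by apply: contraTneq ms => ->.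
exists m; split=> // [|j mj]; first by rewrite !inE eqxx (negPf nim).
rewrite !inE; have -> : (j == m) = false by apply: gtn_eqF.
by have -> : (j == i) = false by apply: gtn_eqF; apply: ltn_trans im mj.
Qed.

(** The property that singles out the reverse lexicographic order: monomials
    in the first k variables are larger than all other monomials of the same
    degree. *)
Lemma revlex_max_index s t k : #|s| = #|t| -> (max_index s <= k)%N ->
    (k < max_index t)%N ->
  revlex_lt t s.
Proof.
move=> e sk kt; apply/revlexP; right; split=> //.
have [|m mt em] := @max_index_attained _ t.
  by apply: contraTneq kt => ->; rewrite -leqNgt; apply: leq_trans (leq0n _);
    apply/max_index_leP => i; rewrite inE.
have notin (j : 'I_n) : (m <= j)%N -> j \in s = false.
  by move=> mj; apply/negP => /ltn_max_index; lia.
exists m; split=> // [|j mj]; first by rewrite notin.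
rewrite notin; last exact: ltnW.
by apply/negP => /ltn_max_index; lia.
Qed.

End Revlex.

(** * Linear substitutions in the exterior algebra *)

Section ExteriorAction.

Variables (K : fieldType) (n : nat).
Local Notation E := (exterior K n).
Implicit Types (f h a : E) (s t A B C : {set 'I_n}) (g x y : 'M[K]_n).
Local Notation e_ := (@ext_basis K n).
Local Notation v_ := (@ext_var K n).

(** Image of the basis vector e_i under the linear map of matrix g. *)
Definition lform g (i : 'I_n) : E := \sum_(j < n) g j i *: v_ j.

Lemma ext_actE g f : ext_act g f = \sum_s f s *: \prod_(i in s) lform g i.
Proof. by []. Qed.

Lemma ext_act_linear g : linear (ext_act g).
Proof.
move=> c f h; rewrite !ext_actE scaler_sumr -big_split;
  apply: eq_bigr => s _ /=.
by rewrite !ffunE scalerDl scalerA.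
Qed.

HB.instance Definition _ g := GRing.isLinear.Build K E E *:%R (ext_act g)
  (ext_act_linear g).

Lemma ext_actZ g (c : K) f : ext_act g (c *: f) = c *: ext_act g f.
Proof. exact: linearZ. Qed.

Lemma ext_act0 g : ext_act g 0 = 0.
Proof. exact: linear0. Qed.

Lemma ext_actN g f : ext_act g (- f) = - ext_act g f.
Proof. exact: linearN. Qed.

Lemma ext_act_sum g I (r : seq I) (P : pred I) (F : I -> E) :
  ext_act g (\sum_(i <- r | P i) F i) = \sum_(i <- r | P i) ext_act g (F i).
Proof. exact: linear_sum. Qed.

Lemma ext_basis_coef s t : e_ s t = (t == s)%:R.
Proof. by rewrite ffunE. Qed.

Lemma ext_act_basis g s : ext_act g (e_ s) = \prod_(i in s) lform g i.
Proof.
rewrite ext_actE (bigD1 s) //= [X in _ + X]big1 => [|t /negPf ts].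
  by rewrite addr0 ext_basis_coef eqxx scale1r.
by rewrite ext_basis_coef ts scale0r.
Qed.

Lemma ext_mulE A B : e_ A * e_ B =
  if [disjoint A & B] then (-1) ^+ inversions A B *: e_ (A :|: B) else 0.
Proof. exact: ext_mul_basis. Qed.

Lemma inversions_lt A B : (forall i j, i \in A -> j \in B -> (i < j)%N) ->
  inversions A B = 0%N.
Proof.
move=> h; apply: eq_card0 => -[i j]; rewrite !inE /=;
  apply/and3P => -[iA jB ji].
by have := h i j iA jB; rewrite ltnNge ltnW.
Qed.

Lemma inversions1 (i j : 'I_n) : inversions [set i] [set j] = (j < i)%N.
Proof.
rewrite /inversions
  (_ : [set _ | _] = if (j < i)%N then [set (i, j)] else set0).
  by case: ifP; rewrite ?cards1 ?cards0.
apply/setP => -[k l]; rewrite !inE /=.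
case: ifP => ji; rewrite !inE.
  by apply/and3P/eqP => [[/eqP-> /eqP->]|[-> ->]].
by apply/and3P => -[/eqP-> /eqP->]; rewrite ji.
Qed.

Lemma ext_varC (i j : 'I_n) : v_ i * v_ j = - (v_ j * v_ i).
Proof.
rewrite !ext_mulE !disjoints1 !inE eq_sym.
case: eqP => [_|ij]; first by rewrite oppr0.
rewrite setUC !inversions1 -scaleNr; congr (_ *: _).
case: (ltngtP i j) => [||/val_inj]; rewrite ?opprK //.
by move=> e; case: ij.
Qed.

(** The two properties of a linear form that products of linear forms use;
    together they are stable under adding a multiple of a basis vector, which
    yields a square equal to 0 also in characteristic 2. *)
Definition is_lform a := a * a = 0 /\ forall j, a * v_ j = - (v_ j * a).

Lemma lform_odd g i : is_lform (lform g i).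
Proof.
rewrite /lform; elim/big_rec: _ => [|j a _ [aa av]].
  by split=> [|j]; rewrite !(mul0r, mulr0) ?oppr0.
split=> [|k]; last first.
  by rewrite mulrDl mulrDr -scalerAl -scalerAr ext_varC av scalerN opprD.
rewrite mulrDl !mulrDr aa addr0 -!scalerAl -!scalerAr ext_var_sqr !scaler0
  add0r.
by rewrite av scalerN subrr.
Qed.

Lemma lform_anticomm g i j : lform g i * lform g j = - (lform g j * lform g i).
Proof.
rewrite {2 3}/lform mulr_sumr mulr_suml -sumrN; apply: eq_bigr => k _.
by rewrite -scalerAr -scalerAl (lform_odd g i).2 scalerN.
Qed.

Lemma enum_setU1_lt (i : 'I_n) B : (forall j, j \in B -> (i < j)%N) ->
  enum (i |: B) = i :: enum B.
Proof.
have sorted_enum C : sorted (fun j k : 'I_n => j < k)%N (enum C).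
  rewrite /enum_mem; apply: sorted_filter; first by move=> ? ? ?;
    apply: ltn_trans.
  by have := iota_ltn_sorted 0 n; rewrite -val_enum_ord sorted_map enumT.
move=> iB; apply: (@irr_sorted_eq _ (fun j k : 'I_n => j < k)%N).
- by move=> ? ? ?; apply: ltn_trans.
- by move=> j; rewrite ltnn.
- exact: sorted_enum.
- rewrite /= path_sortedE ?sorted_enum ?andbT; last by move=> ? ? ?;
  apply: ltn_trans.
  by apply/allP => j; rewrite mem_enum; apply: iB.
- by move=> j; rewrite mem_enum !inE mem_enum.
Qed.

Lemma prod_enumE (F : 'I_n -> E) A :
  \prod_(i in A) F i = \prod_(i <- enum A) F i.
Proof. by rewrite -big_filter [index_enum _]unlock. Qed.

Lemma ext_act_min g (i : 'I_n) B : (forall j, j \in B -> (i < j)%N) ->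
  ext_act g (v_ i * e_ B) = lform g i * ext_act g (e_ B).
Proof.
move=> iB; have iNB : i \notin B by apply/negP => /iB; rewrite ltnn.
rewrite ext_mulE disjoints1 iNB inversions_lt ?scale1r; last first.
  by move=> j k /set1P -> /iB.
by rewrite !ext_act_basis !prod_enumE enum_setU1_lt // big_cons.
Qed.

(** When i is smaller than all of B this is the ordered product. Otherwise e_i
    is moved past the smallest element b of B on both sides, with the same
    sign, and the claim for B without b applies. *)
Lemma ext_act_var_basis g i B :
  ext_act g (v_ i * e_ B) = lform g i * ext_act g (e_ B).
Proof.
move: {2}#|B| (erefl #|B|) => k; elim: k B => [|k IHk] B cB.
  apply: ext_act_min => j; by rewrite (eqP (_ : B == set0)) ?inE // -cards_eq0
    cB.
have [b0 b0B] : exists b, b \in B by apply/card_gt0P; rewrite cB.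
have [b bB bmin] : exists2 b, b \in B & forall j, j \in B -> (b <= j)%N.
  by have [b bB bmin] := arg_minnP (fun b : 'I_n => b : nat) b0B; exists b.
have blt j : j \in B :\ b -> (b < j)%N.
  case/setD1P => jb /bmin; rewrite leq_eqVlt => /orP[/eqP/val_inj e|//].
  by rewrite e eqxx in jb.
have [ib|] := ltnP i b.
  by apply: ext_act_min => j /bmin; apply: leq_trans.
have eB : e_ B = v_ b * e_ (B :\ b).
  rewrite ext_mulE disjoints1 setD11 inversions_lt ?scale1r ?setD1K //.
  by move=> j l /set1P ->; apply: blt.
have cB' : #|B :\ b| = k by move: cB; rewrite (cardsD1 b) bB => -[].
rewrite leq_eqVlt => /orP[/eqP/val_inj bi|bi].
  rewrite eB -bi mulrA ext_var_sqr mul0r ext_act0 ext_act_min //.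
  by rewrite mulrA (lform_odd g b).1 mul0r.
rewrite eB mulrA ext_varC mulNr ext_actN -mulrA.
rewrite [in RHS](ext_act_min g blt) [RHS]mulrA lform_anticomm mulNr -mulrA -IHk
  //.
congr (- _); rewrite [v_ i * _]ext_mulE; case: ifP => _.
  rewrite -scalerAr !ext_actZ -scalerAr ext_act_min // => j.
  by case/setU1P => [->//|/blt].
by rewrite mulr0 !ext_act0 mulr0.
Qed.

Lemma ext_act_var g i f : ext_act g (v_ i * f) = lform g i * ext_act g f.
Proof.
rewrite [f]ext_basisE mulr_sumr !ext_act_sum mulr_sumr; apply: eq_bigr => s _.
by rewrite -scalerAr !ext_actZ ext_act_var_basis -scalerAr.
Qed.

Lemma ext_act_prod (I : Type) (r : seq I) (F : I -> 'I_n) g f :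
  ext_act g ((\prod_(i <- r) v_ (F i)) * f) =
  (\prod_(i <- r) lform g (F i)) * ext_act g f.
Proof.
elim: r => [|i r IHr]; first by rewrite !big_nil !mul1r.
by rewrite !big_cons -!mulrA ext_act_var IHr.
Qed.

(** [ext_act g] is defined by ordered products on the basis; that it is a ring
    morphism is the universal property of the exterior algebra. *)
Lemma ext_actM g f h : ext_act g (f * h) = ext_act g f * ext_act g h.
Proof.
rewrite [f]ext_basisE mulr_suml !ext_act_sum mulr_suml; apply: eq_bigr => s _.
rewrite -scalerAl !ext_actZ -scalerAl; congr (_ *: _).
by rewrite ext_act_basis ext_basis_prod !prod_enumE ext_act_prod.
Qed.

Lemma ext_act1 g : ext_act g 1 = 1.
Proof. by have := ext_act_basis g set0; rewrite big_set0. Qed.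

Lemma ext_act_ext_var g i : ext_act g (v_ i) = lform g i.
Proof. by rewrite -[v_ i]mulr1 ext_act_var ext_act1 mulr1. Qed.

Lemma ext_act_lform g x i : ext_act g (lform x i) = lform (g *m x) i.
Proof.
rewrite ext_act_sum; under eq_bigr do rewrite ext_actZ ext_act_ext_var
  scaler_sumr.
rewrite exchange_big; apply: eq_bigr => j _ /=.
rewrite mxE scaler_suml; apply: eq_bigr => k _.
by rewrite scalerA mulrC.
Qed.

Lemma ext_act_comp g x f : ext_act g (ext_act x f) = ext_act (g *m x) f.
Proof.
rewrite [f]ext_basisE (ext_act_sum x) (ext_act_sum g) (ext_act_sum (g *m x)).
apply: eq_bigr => s _; rewrite !ext_actZ; congr (_ *: _);
  rewrite !ext_act_basis.
rewrite (big_morph (ext_act g) (ext_actM g) (ext_act1 g)).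
by apply: eq_bigr => i _; apply: ext_act_lform.
Qed.

Lemma lform1 i : lform 1%:M i = v_ i.
Proof.
rewrite /lform (bigD1 i) //= mxE eqxx scale1r big1 ?addr0 // => j /negPf ji.
by rewrite mxE ji scale0r.
Qed.

Lemma ext_act_id f : ext_act 1%:M f = f.
Proof.
rewrite [f]ext_basisE ext_act_sum; apply: eq_bigr => s _; rewrite ext_actZ.
rewrite ext_act_basis [in RHS]ext_basis_prod; congr (_ *: _).
by apply: eq_bigr => i _; apply: lform1.
Qed.

Lemma ext_actK g : g \in unitmx -> cancel (ext_act g) (ext_act (invmx g)).
Proof. by move=> gu f; rewrite ext_act_comp mulVmx ?ext_act_id. Qed.

Lemma ext_actKV g : g \in unitmx -> cancel (ext_act (invmx g)) (ext_act g).
Proof. by move=> gu f; rewrite ext_act_comp mulmxV ?ext_act_id. Qed.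

Lemma sum_neq0 (I : finType) (F : I -> K) :
  \sum_i F i != 0 -> exists i, F i != 0.
Proof.
move=> h; apply/existsP; apply: contraNT h => /existsPn h.
by rewrite big1 // => i _; apply/eqP; move: (h i); rewrite negbK.
Qed.

Lemma ext_mul_neq0 f h t : (f * h) t != 0 ->
  exists A B, [/\ f A != 0, h B != 0, [disjoint A & B] & t = A :|: B].
Proof.
have -> : f * h = \sum_A \sum_B (f A * h B) *: (e_ A * e_ B).
  rewrite [f in LHS]ext_basisE [h in LHS]ext_basisE mulr_suml.
  apply: eq_bigr => A _; rewrite mulr_sumr; apply: eq_bigr => B _.
  by rewrite -scalerAl -scalerAr scalerA.
rewrite sum_ffunE => /sum_neq0[A]; rewrite sum_ffunE => /sum_neq0[B].
rewrite ext_mulE ffunE !mulf_eq0 !negb_or -andbA => /and3P[fA hB].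
case: ifP => dAB; last by rewrite ffunE eqxx.
rewrite !ffunE; have [-> _|_] := eqVneq t (A :|: B); first by exists A, B.
by rewrite [_ *: _]mulr0 eqxx.
Qed.

Lemma ext_basis_mulE B h t : (e_ B * h) t =
  if B \subset t then (-1) ^+ inversions B (t :\: B) * h (t :\: B) else 0.
Proof.
rewrite {1}[h]ext_basisE mulr_sumr sum_ffunE; case: ifP => Bt.
  rewrite (bigD1 (t :\: B)) //= big1 ?addr0 => [|C CtB].
    have tE : B :|: (t :\: B) = t by rewrite -{2}(setID t B) (setIidPr Bt).
    have dB : [disjoint B & t :\: B].
      by rewrite -setI_eq0; apply/eqP/setP => i; rewrite !inE; case: (i \in B).
    rewrite -scalerAr ext_mulE dB tE !ffunE eqxx [_ *: 1]mulr1.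
    exact: mulrC.
  rewrite -scalerAr ext_mulE; case: ifP => dBC; last by rewrite scaler0 ffunE.
  rewrite !ffunE; case: eqP => [e|_]; last by rewrite ![_ *: 0]mulr0.
  case/eqP: CtB; apply/setP => i; rewrite e !inE; case iB: (i \in B) => //=.
  by apply/negbTE; rewrite (disjointFr dBC).
rewrite big1 // => C _; rewrite -scalerAr ext_mulE; case: ifP => dBC;
  last by rewrite scaler0 ffunE.
rewrite !ffunE; case: eqP => [e|_]; last by rewrite ![_ *: 0]mulr0.
by rewrite e subsetUl in Bt.
Qed.

Definition ext_homog d f := forall t, f t != 0 -> #|t| = d.

Lemma ext_act_homog g s : ext_homog #|s| (ext_act g (e_ s)).
Proof.
rewrite ext_act_basis -sum1_card.
elim/big_rec2: _ => [t|i d f _ hf t].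
  by rewrite ffunE; have [->|_] := eqVneq t set0; rewrite ?cards0 ?eqxx.
case/ext_mul_neq0 => A [B [hA /hf cB dAB ->]].
rewrite cardsU (_ : A :&: B = set0) ?cards0 ?subn0; last by apply/eqP;
  rewrite setI_eq0.
rewrite cB; congr addn; move: hA; rewrite sum_ffunE => hA.
apply/eqP; apply: contraNT hA => cA; rewrite big1 // => j _.
rewrite !ffunE; case: eqP => [e|_]; last exact: mulr0.
by rewrite e cards1 eqxx in cA.
Qed.

Definition ext_part d f : E :=
  [ffun s : {set 'I_n} => if #|s| == d then f s else 0].

(** Substitutions preserve the degree. *)
Lemma ext_act_part g f t : (ext_act g f) t = (ext_act g (ext_part #|t| f)) t.
Proof.
rewrite !ext_actE !sum_ffunE; apply: eq_bigr => s _; rewrite !ffunE.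
case: ifP => // st; rewrite scale0r -ext_act_basis.
have /eqP -> : (ext_act g (e_ s) t == 0) by apply: contraFT st =>
  /ext_act_homog ->.
exact: scaler0.
Qed.

End ExteriorAction.

(** * Initial monomials and shears *)

Section InitialSets.

Variables (K : fieldType) (n : nat).
Local Notation E := (exterior K n).
Implicit Types (f h : E) (s t A B C : {set 'I_n}) (g x y : 'M[K]_n).
Implicit Types (J : E -> Prop) (D De N : {set {set 'I_n}}).
Local Notation e_ := (@ext_basis K n).
Local Notation v_ := (@ext_var K n).

Lemma ext_scaleE (c : K) f : c *: f = (c *: 1) * f.
Proof. by rewrite -scalerAl mul1r. Qed.

Lemma ext_SR_idealE D f : (forall s t, s \in D -> t \subset s -> t \in D) ->
  ext_SR_ideal K D f <-> forall s, f s != 0 -> s \notin D.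
Proof.
move=> downD; split=> [h|h I [I0 ID IM] IX].
  apply: (h (fun f => forall s, f s != 0 -> s \notin D)).
    split=> [s|a b ha hb s|r a ha]; first by rewrite ffunE eqxx.
      rewrite ffunE; have [a0|/ha //] := eqVneq (a s) 0.
      by rewrite a0 add0r => /hb.
    split=> s /ext_mul_neq0[A [B [hA hB _ ->]]].
      by apply: contra (ha _ hB) => /downD; apply; apply: subsetUr.
    by apply: contra (ha _ hA) => /downD; apply; apply: subsetUl.
  move=> _ [s sD ->] t; rewrite ext_basis_coef.
  by have [->|] := eqVneq t s; rewrite ?eqxx.
rewrite [f]ext_basisE; elim/big_ind: _ => // s _.
have [->|fs] := eqVneq (f s) 0; first by rewrite scale0r.
rewrite ext_scaleE; apply: (IM _ _ _).1; apply: IX; exists s => //; exact: h.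
Qed.

Definition initial_set J s := exists2 h, J h & is_initial h s.

Lemma initial_basis_mul B h s : is_initial h s -> [disjoint B & s] ->
  is_initial (e_ B * h) (B :|: s).
Proof.
move=> [hs hlt] dBs; split=> [|t].
  rewrite ext_basis_mulE subsetUl mulf_neq0 ?signr_eq0 //.
  rewrite setDUl setDv set0U (_ : s :\: B = s) //.
  by apply/setDidPl; rewrite disjoint_sym.
rewrite ext_basis_mulE; case: ifP => Bt; last by rewrite eqxx.
rewrite mulf_eq0 negb_or => /andP[_ ht] ts.
apply: revlex_setU => //; apply: hlt => //; apply: contraNneq ts => <-.
by rewrite -{1}(setID t B) (setIidPr Bt).
Qed.

(** Multiplying by the missing basis vectors multiplies the initial monomial.
    *)
Lemma initial_set_up J s t : (forall f h, J h -> J (f * h)) ->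
    initial_set J s ->
  s \subset t -> initial_set J t.
Proof.
move=> JM [h Jh hs] st; exists (e_ (t :\: s) * h); first exact: JM.
rewrite -{2}(setID t s) (setIidPr st) setUC.
apply: initial_basis_mul => //.
by rewrite -setI_eq0; apply/eqP/setP => i; rewrite !inE; case: (i \in s);
  rewrite ?andbF.
Qed.

Lemma initial_idealE J f : (forall f h, J h -> J (f * h)) ->
  initial_ideal J f <-> forall s, f s != 0 -> initial_set J s.
Proof.
move=> JM; split=> [h|h I [I0 ID IM] IX].
  apply: (h (fun f => forall s, f s != 0 -> initial_set J s)).
    split=> [s|a b ha hb s|r a ha]; first by rewrite ffunE eqxx.
      rewrite ffunE; have [a0|/ha //] := eqVneq (a s) 0.
      by rewrite a0 add0r => /hb.
    split=> s /ext_mul_neq0[A [B [hA hB _ ->]]].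
      exact: initial_set_up (ha _ hB) (subsetUr _ _).
    exact: initial_set_up (ha _ hA) (subsetUl _ _).
  move=> _ [k [s [Jk ks ->]]] t; rewrite ext_basis_coef.
  by have [->|] := eqVneq t s; rewrite ?eqxx //; exists k.
rewrite [f]ext_basisE; elim/big_ind: _ => // s _.
have [->|/h[k Jk ks]] := eqVneq (f s) 0; first by rewrite scale0r.
by rewrite ext_scaleE; apply: (IM _ _ _).1; apply: IX; exists k, s.
Qed.

Lemma ext_image_mull g J : g \in unitmx -> (forall f h, J h -> J (f * h)) ->
  forall f h, ext_image g J h -> ext_image g J (f * h).
Proof.
move=> gu JM f _ [k Jk ->]; exists (ext_act (invmx g) f * k); first exact: JM.
by rewrite ext_actM ext_actKV.
Qed.

Lemma ext_SR_mull D f h : ext_SR_ideal K D h -> ext_SR_ideal K D (f * h).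
Proof.
by move=> hD I hI IX; have [_ _ IM] := hI; apply: (IM _ _ _).1; apply: hD.
Qed.

(** The initial monomials of an ideal are closed under multiplication by basis
    vectors, hence they are all the monomials of the ideal they generate. *)
Lemma gin_initial_set D De g : g \in unitmx ->
  (forall s t, s \in De -> t \subset s -> t \in De) ->
  (forall f, initial_ideal (ext_image g (ext_SR_ideal K D)) f <->
     ext_SR_ideal K De f) ->
  forall s, s \notin De <-> initial_set (ext_image g (ext_SR_ideal K D)) s.
Proof.
move=> gu downDe H s.
have JM := ext_image_mull gu (@ext_SR_mull D).
split=> [sDe|hs].
  apply: (initial_idealE (e_ s) JM).1.
    apply/H; apply/ext_SR_idealE => // t; rewrite ext_basis_coef.
    by have [->|] := eqVneq t s; rewrite ?eqxx.
  by rewrite ext_basis_coef eqxx oner_eq0.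
have /H : initial_ideal (ext_image g (ext_SR_ideal K D)) (e_ s).
  apply/initial_idealE => // t; rewrite ext_basis_coef.
  by have [->|] := eqVneq t s; rewrite ?eqxx.
by move=> /ext_SR_idealE => /(_ downDe s); rewrite ext_basis_coef eqxx oner_eq0;
  apply.
Qed.

Lemma ext_basis_D1 A (m : 'I_n) : m \in A ->
  e_ A = (-1) ^+ inversions [set m] (A :\ m) *: (v_ m * e_ (A :\ m)).
Proof.
move=> mA; rewrite ext_mulE disjoints1 setD11 /= setD1K //.
by rewrite scalerA -expr2 sqrr_sign scale1r.
Qed.

Section Shear.

Variables (c : K) (i m : 'I_n).
Hypothesis im : (i < m)%N.
Let x : 'M[K]_n := 1%:M + c *: delta_mx i m.

Lemma lform_shear j : lform x j = v_ j + (if j == m then c *: v_ i else 0).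
Proof.
rewrite /lform; under eq_bigr do rewrite !mxE scalerDl.
rewrite big_split /=; congr (_ + _).
  by rewrite -[RHS]lform1; apply: eq_bigr => k _; rewrite mxE.
case: ifP => jm; last by rewrite big1 // => k _; rewrite andbF mulr0 scale0r.
rewrite (bigD1 i) //= eqxx mulr1 big1 ?addr0 // => k /negPf ki.
by rewrite ki mulr0 scale0r.
Qed.

Lemma ext_act_shear_notin A : m \notin A -> ext_act x (e_ A) = e_ A.
Proof.
move=> mA; rewrite ext_act_basis [RHS]ext_basis_prod; apply: eq_bigr => j jA.
rewrite lform_shear; case: eqP => [e|]; last by rewrite addr0.
by rewrite -e jA in mA.
Qed.

Lemma ext_act_shear_in A : m \in A -> ext_act x (e_ A) =
  e_ A + (c * (-1) ^+ inversions [set m] (A :\ m)) *: (v_ i * e_ (A :\ m)).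
Proof.
move=> mA; have eA := ext_basis_D1 mA.
rewrite {1}eA ext_actZ ext_act_var lform_shear eqxx ext_act_shear_notin;
  last by rewrite setD11.
by rewrite mulrDl scalerDr -eA -scalerAl scalerA mulrC.
Qed.

(** The shear by x sends e_m to e_m + c e_i and fixes the other basis vectors,
    so it adds to e_A, for A containing m, the term with m replaced by i. *)
Lemma shear_coef h t : ext_act x h t = h t + \sum_(A : {set 'I_n} | m \in A)
  h A * (c * (-1) ^+ inversions [set m] (A :\ m)) * (v_ i * e_ (A :\ m)) t.
Proof.
rewrite {1}[h]ext_basisE ext_act_sum sum_ffunE.
rewrite (bigID (fun A : {set 'I_n} => m \in A)) /= addrC.
have hE : h t = \sum_(A : {set 'I_n} | m \notin A) (h A *: e_ A) t +
  \sum_(A : {set 'I_n} | m \in A) (h A *: e_ A) t.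
  rewrite {1}[h]ext_basisE sum_ffunE (bigID (fun A : {set 'I_n} => m \in A)).
  exact: addrC.
rewrite hE -addrA -big_split /=; congr (_ + _); apply: eq_bigr => A mA.
  by rewrite ext_actZ ext_act_shear_notin.
rewrite ext_actZ ext_act_shear_in // !ffunE [LHS]mulrDr; congr (_ + _).
exact: mulrA.
Qed.

Lemma var_basis_coef A t : (v_ i * e_ (A :\ m)) t != 0 ->
  i \notin A /\ t = i |: (A :\ m).
Proof.
rewrite ext_mulE disjoints1 !inE.
have -> : (i != m) by rewrite neq_ltn im.
case: ifP => iA; last by rewrite ffunE eqxx.
rewrite !ffunE; have [->|_] := eqVneq t (i |: A :\ m); first by [].
by rewrite [_ *: _]mulr0 eqxx.
Qed.

(** The monomial with m replaced by i < m is larger than the initial monomial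
    e_s, so it does not occur in h and its coefficient in the sheared element
    is c times that of e_s, up to sign. Every other new monomial comes by the
    same replacement from a monomial below e_s. As a monomial contains e_m at
    most once, no binomial coefficient appears, whence the independence of the
    characteristic. *)
Lemma initial_shear h s : c != 0 -> m \in s -> i \notin s -> is_initial h s ->
  is_initial (ext_act x h) (i |: (s :\ m)).
Proof.
move=> c0 ms is_ [hs hlt].
have nim : i != m by rewrite neq_ltn im.
have st0 := revlex_lt_swap ms is_ im.
split=> [|t].
  rewrite shear_coef (bigD1 s) //= [X in _ + (_ + X)]big1 ?addr0 =>
    [|A /andP[mA As]].
    rewrite (_ : h _ = 0) ?add0r; last first.
      apply/eqP; apply: contraT => /hlt; case: eqP => [e|_ /(_ isT) lt].
        by rewrite e revlex_irr in st0.
      by case: (revlex_asym st0 lt).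
    rewrite !mulf_neq0 ?signr_eq0 // ext_mulE disjoints1 !inE nim is_ /= !ffunE
      eqxx.
    by rewrite [_ *: _]mulr1 signr_eq0.
  apply/eqP; rewrite mulf_eq0; apply/orP; right; apply: contraNT As.
  case/var_basis_coef => iA e; apply/eqP.
  rewrite -(setD1K ms) -(setD1K mA); congr (_ |: _).
  have iDs : i \notin s :\ m by rewrite !inE negb_and is_ orbT.
  have iDA : i \notin A :\ m by rewrite !inE negb_and iA orbT.
  by rewrite -(setU1K iDs) -(setU1K iDA) e.
rewrite shear_coef => ht tt0.
have [ht0|/hlt lt] := eqVneq (h t) 0; last first.
  have [e|/lt ts] := eqVneq t s; first by rewrite e.
  exact: revlex_trans ts st0.
move: ht; rewrite ht0 add0r big_mkcond => /sum_neq0[A]; case: ifP => mA;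
  last by rewrite eqxx.
rewrite !mulf_eq0 !negb_or => /andP[/andP[hA _] /var_basis_coef[iA e]].
rewrite e; apply: revlex_swap => //; apply: hlt => //.
by apply: contraNneq tt0 => <-; rewrite e.
Qed.

End Shear.

End InitialSets.

(** * Generic matrices over an infinite field *)

Section Generic.

Variables (K : fieldType) (n : nat).
Implicit Types (g d : 'M[K]_n) (U : 'M[K]_n -> Prop).

Lemma poly_nonroot (q : {poly K}) : infinite_field K -> q != 0 ->
  exists c, q.[c] != 0.
Proof.
move=> infK q0.
have [rs urs srs] : exists2 rs : seq K, uniq rs & size rs = size q.
  elim: (size q) => [|k [rs urs <-]]; first by exists [::].
  by have [x xrs] := infK rs; exists (x :: rs); rewrite //= xrs.
have : ~~ all (root q) rs.
  by apply/negP => /(max_poly_roots q0)/(_ urs); rewrite srs ltnn.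
by case/allPn => c _ qc; exists c.
Qed.

(** The generic point g + X d of a line of matrices. All genericity arguments
    are made on such lines, with polynomials in one variable. *)
Definition line_mx g d : 'M[{poly K}]_n :=
  map_mx polyC g + 'X *: map_mx polyC d.

Lemma horner_line_mx g d c :
  map_mx (horner_eval c) (line_mx g d) = g + c *: d.
Proof.
by apply/matrixP => i j; rewrite !mxE /horner_eval !hornerE.
Qed.

(** A polynomial in the entries that does not vanish at g restricts to a
    polynomial in one variable that does not vanish at 0; so does the
    determinant. *)
Lemma zariski_open_line U g d : zariski_open_GL U -> U g ->
  exists2 q : {poly K}, q.[0] != 0 & forall c, q.[c] != 0 -> U (g + c *: d).
Proof.
move=> [Uunit [P UP]] Ug; have gu := Uunit g Ug.
have [p Pp pg] := (UP g gu).1 Ug.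
pose r : {poly K} := mmap polyC (fun k => mxvec (line_mx g d) 0 k) p.
have rE c : r.[c] = p.@[fun k => mxvec (g + c *: d) 0 k].
  rewrite mevalE /r /mmap horner_sum; apply: eq_bigr => m _.
  rewrite hornerM hornerC /mmap1 horner_prod; congr (_ * _).
  apply: eq_bigr => k _; rewrite horner_exp -horner_line_mx; congr (_ ^+ _).
  by rewrite -map_mxvec mxE.
have detE c : (\det (line_mx g d)).[c] = \det (g + c *: d).
  by rewrite -horner_line_mx det_map_mx.
exists (\det (line_mx g d) * r) => [|c].
  rewrite hornerM detE rE scale0r addr0 mulf_neq0 //.
  by rewrite -unitfE -unitmxE.
rewrite hornerM detE rE mulf_eq0 negb_or -unitfE -unitmxE => /andP[u pc].
by apply/(UP _ u); exists p.
Qed.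

(** The block diagonal matrix formed of the upper left corner of size k of g
    and an identity matrix: its determinant is the leading principal minor of
    size k. *)
Definition corner_mx k g : 'M[K]_n :=
  pid_mx k *m g *m pid_mx k + (1%:M - pid_mx k).

Lemma corner_mx1 k : (k <= n)%N -> corner_mx k 1%:M = 1%:M.
Proof. by move=> kn; rewrite /corner_mx mulmx1 pid_mx_id // addrC subrK. Qed.

(** On the line joining a point of U to the identity matrix, the polynomials
    expressing membership in U and nonvanishing of the leading minors are all
    nonzero: look at the first at 0, and at the others at 1. *)
Lemma zariski_open_generic U : infinite_field K -> zariski_open_GL U ->
  (exists g, U g) ->
  exists2 g, U g & forall k, (k <= n)%N -> corner_mx k g \in unitmx.
Proof.
move=> infK oU [g Ug]; pose d := 1%:M - g.
have [q q0 qU] := zariski_open_line d oU Ug.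
pose C k : 'M[{poly K}]_n :=
  pid_mx k *m line_mx g d *m pid_mx k + (1%:M - pid_mx k).
have CE k c : (\det (C k)).[c] = \det (corner_mx k (g + c *: d)).
  rewrite -[LHS]/(horner_eval c _) -det_map_mx; congr (\det _).
  rewrite map_mxD !map_mxM map_mxB horner_line_mx map_mx1.
  by rewrite !map_pid_mx.
have C0 k : (k <= n)%N -> \det (C k) != 0.
  move=> kn; apply/eqP => /(congr1 (fun r => r.[1]));
    rewrite CE horner0 scale1r addrC subrK.
  by rewrite corner_mx1 // det1 => /eqP; rewrite oner_eq0.
have qn0 : q != 0 by apply: contraNneq q0 => ->; rewrite horner0.
have [|c] := @poly_nonroot (q * \prod_(k < n.+1) \det (C k)) infK.
  rewrite mulf_neq0 //; apply/prodf_neq0 => k _; apply: C0.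
  by rewrite -ltnS ltn_ord.
rewrite hornerM mulf_eq0 negb_or horner_prod => /andP[/qU Uc /prodf_neq0 Cc].
exists (g + c *: d) => // k kn; rewrite unitmxE unitfE -CE.
exact: (Cc (Ordinal (kn : (k < n.+1)%N))).
Qed.

End Generic.

(** * Initial monomials count dimensions *)

Section LeadCount.

Variables (K : fieldType) (n : nat).
Local Notation E := (exterior K n).
Implicit Types (f h : E) (s t A B C : {set 'I_n}) (g x y : 'M[K]_n).
Local Notation e_ := (@ext_basis K n).

(** The order is total and finite; the rank of a set is its number of
    predecessors. *)
Lemma exists_initial f : f != 0 -> exists s, is_initial f s.
Proof.
move=> f0; pose rank s := #|[set t | revlex_lt t s]|.
have rank_lt s t : revlex_lt s t -> (rank s < rank t)%N.
  move=> st; apply: proper_card; apply/properP; split.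
    by apply/subsetP => u; rewrite !inE => /revlex_trans; apply.
  by exists s; rewrite !inE ?revlex_irr.
have [s0 fs0] : exists s, f s != 0.
  apply/existsP; apply: contraNT f0 => /existsPn h; apply/eqP/ffunP => s.
  by rewrite ffunE; apply/eqP; move: (h s); rewrite negbK.
have [s fs smax] := @arg_maxnP _ s0 (fun s => f s != 0) rank fs0.
exists s; split=> // t ft ts; case: (revlex_total ts) => // /rank_lt.
by move: (smax t ft) => /= le; rewrite ltnNge le.
Qed.

(** Elements with distinct initial monomials are independent, since the
    largest initial monomial of a linear combination cannot cancel. Conversely
    an element of W whose coefficients at all initial monomials of W vanish is
    zero, so W embeds into the coordinate space on X. *)
Lemma lead_count (W : {vspace E}) (X : {set {set 'I_n}}) :
  (forall s, s \in X <-> exists2 h, h \in W & is_initial h s) ->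
  #|X| = \dim W.
Proof.
move=> XP; apply/eqP; rewrite eqn_leq; apply/andP; split.
  have [h hP] : exists h : {set 'I_n} -> E,
      forall s, s \in X -> h s \in W /\ is_initial (h s) s.
    apply: (@fin_all_exists _ (fun=> E)
      (fun s h => s \in X -> h \in W /\ is_initial h s)) => s.
    have [/XP[h hW hs]|_] := boolP (s \in X); first by exists h.
    by exists 0.
  pose t : #|X|.-tuple E := [tuple h (enum_val i) | i < #|X|].
  have tE (i : 'I_#|X|) : t`_i = h (enum_val i).
    by rewrite -tnth_nth tnth_mktuple.
  have ft : free t.
    apply/freeP => k sum0 i; apply/eqP; apply: contraT => ki.
    (* The coefficients of a dependency are stored as a vector F, whose
       initial monomial is the largest index with a nonzero coefficient. *)
    pose F : E :=
      [ffun s : {set 'I_n} => \sum_(i < #|X| | enum_val i == s) k i].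
    have FE (l : 'I_#|X|) : F (enum_val l) = k l.
      rewrite ffunE (big_pred1 l) // => l' /=; exact: (inj_eq enum_val_inj).
    have F0 : F != 0.
      by apply: contraNneq ki => F0; rewrite -FE F0 ffunE.
    have [s [Fs Fmax]] := exists_initial F0.
    have [l ls] : exists l : 'I_#|X|, enum_val l = s.
      move: Fs; rewrite ffunE => Fs.
      have [l] : exists l : 'I_#|X|, enum_val l == s.
        apply/existsP; apply: contraNT Fs => /existsPn H;
          rewrite big_pred0 // => l.
        by apply/negbTE/H.
      by move/eqP; exists l.
    have sX : s \in X by rewrite -ls; apply: enum_valP.
    have /ffunP/(_ s) := sum0; rewrite sum_ffunE ffunE (bigD1 l) //= big1 =>
      [|l' l'l].
      rewrite addr0 ffunE tE ls => /eqP; rewrite mulf_eq0 => /orP[kl|].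
        by rewrite -ls FE kl in Fs.
      by have [_ [/negPf ->]] := hP s sX.
    rewrite ffunE tE; apply/eqP; rewrite mulf_eq0; apply/norP => -[kl' hl'].
    have l's : enum_val l' != s by rewrite -ls (inj_eq enum_val_inj).
    have lt1 : revlex_lt (enum_val l') s by apply: Fmax; rewrite ?FE.
    have [_ [_ hmax]] := hP _ (enum_valP l').
    have lt2 : revlex_lt s (enum_val l') by apply: hmax; rewrite // eq_sym.
    exact: revlex_asym lt1 lt2.
  rewrite -[X in (X <= _)%N](size_tuple t) -(eqP ft); apply: dimvS.
  apply/span_subvP => _ /tnthP[i ->]; rewrite tnth_mktuple.
  by have [] := hP _ (enum_valP i).
pose r f : E := \sum_(s in X) f s *: e_ s.
have r_lin : linear r.
  move=> c f h; rewrite /r scaler_sumr -big_split; apply: eq_bigr => s _ /=.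
  by rewrite !ffunE scalerDl scalerA.
pose rL := GRing.isLinear.Build K E E *:%R r r_lin.
pose rl : {linear E -> E} := HB.pack r rL.
have rE f s : s \in X -> r f s = f s.
  move=> sX; rewrite sum_ffunE (bigD1 s) //= big1 => [|t /andP[_ /negPf ts]].
    by rewrite addr0 !ffunE eqxx; apply: mulr1.
  by rewrite !ffunE eq_sym ts; apply: mulr0.
have ker0 : (W :&: lker (linfun rl) = 0)%VS.
  apply/eqP; rewrite -subv0; apply/subvP => f /memv_capP[fW].
  rewrite memv_ker lfunE /= memv0 => /eqP rf0; apply: contraT => f0.
  have [s fs] := exists_initial f0.
  have sX : s \in X by apply/XP; exists f.
  by case: fs; rewrite -(rE _ _ sX) [r f]rf0 ffunE eqxx.
rewrite -(limg_dim_eq ker0).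
have : (linfun rl @: W <= <<[seq e_ s | s <- enum X]>>)%VS.
  apply/subvP => _ /memv_imgP[f _ ->]; rewrite lfunE /=;
    apply: memv_suml => s sX.
  by apply: memvZ; apply: memv_span; apply: map_f; rewrite mem_enum.
move/dimvS => /leq_trans; apply; apply: leq_trans (dim_span _) _.
by rewrite size_map -cardE.
Qed.

End LeadCount.

(** * The generic initial ideal of a stable ideal *)

Section SegmentCounts.

Variables (K : fieldType) (n : nat).
Local Notation E := (exterior K n).
Implicit Types (f h : E) (s t A B C : {set 'I_n}) (g x y : 'M[K]_n).
Implicit Types (X N D De : {set {set 'I_n}}).
Local Notation e_ := (@ext_basis K n).
Local Notation v_ := (@ext_var K n).

Lemma lform_mul g x i : lform (g *m x) i = \sum_j x j i *: lform g j.
Proof.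
rewrite -ext_act_lform /lform ext_act_sum; apply: eq_bigr => j _.
by rewrite ext_actZ ext_act_ext_var.
Qed.

Lemma pid_mulE k x (i m : 'I_n) :
  (pid_mx k *m x) i m = if (i < k)%N then x i m else 0.
Proof.
rewrite mxE (bigD1 i) //= big1 ?addr0 => [|j /negPf ji].
  by rewrite mxE eqxx /=; case: ifP; rewrite ?mul1r ?mul0r.
by rewrite mxE eq_sym val_eqE ji mul0r.
Qed.

Lemma mul_pidE k x (i m : 'I_n) :
  (x *m pid_mx k) i m = if (m < k)%N then x i m else 0.
Proof.
rewrite mxE (bigD1 m) //= big1 ?addr0 => [|j /negPf ji].
  by rewrite mxE eqxx /=; case: ifP; rewrite ?mulr1 ?mulr0.
by rewrite mxE val_eqE ji mulr0.
Qed.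

Lemma lform_pid k (i : 'I_n) :
  lform (pid_mx k : 'M[K]_n) i = if (i < k)%N then v_ i else 0.
Proof.
rewrite /lform (bigD1 i) //= big1 ?addr0 => [|j /negPf ji].
  by rewrite mxE eqxx /=; case: ifP; rewrite ?scale1r ?scale0r.
by rewrite mxE val_eqE ji scale0r.
Qed.

(** Setting the basis vectors beyond the first k to zero. *)
Lemma ext_act_pid k f t :
  ext_act (pid_mx k) f t = if (max_index t <= k)%N then f t else 0.
Proof.
have basis s : ext_act (pid_mx k) (e_ s) =
    if (max_index s <= k)%N then e_ s else 0.
  case: ifP => [/max_index_leP sk|].
    rewrite ext_act_basis [RHS]ext_basis_prod; apply: eq_bigr => i /sk ik.
    by rewrite lform_pid ik.
  rewrite max_index_leE => /negbT; rewrite negb_forall => /existsP[i].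
  rewrite negb_imply => /andP[si /negPf ik].
  rewrite (ext_basis_D1 K si) ext_actZ ext_act_var lform_pid ik mul0r.
  exact: scaler0.
rewrite [f in LHS]ext_basisE ext_act_sum sum_ffunE (bigD1 t) //= big1 =>
  [|s /negPf st].
  rewrite addr0 ext_actZ basis; case: ifP => _; rewrite !ffunE;
    last exact: mulr0.
  by rewrite eqxx; apply: mulr1.
rewrite ext_actZ basis; case: ifP => _; rewrite !ffunE; last exact: mulr0.
by rewrite eq_sym st; apply: mulr0.
Qed.

Definition coord_space X : {vspace E} := <<[seq e_ s | s <- enum X]>>%VS.

Lemma memv_coord_space X f :
  f \in coord_space X <-> forall s, f s != 0 -> s \in X.
Proof.
split=> [|h].
  rewrite /coord_space => fX s fs; rewrite -mem_enum.
  elim: (enum X) f fX fs => [|t l IHl] f /=.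
    by rewrite span_nil memv0 => /eqP ->; rewrite ffunE eqxx.
  rewrite span_cons => /memv_addP[_ /vlineP[c ->] [h hl ->]].
  rewrite !ffunE inE; have [//|_] := eqVneq s t.
  by rewrite [c *: _]mulr0 add0r; apply: IHl.
rewrite [f]ext_basisE; apply: memv_suml => s _.
have [->|fs] := eqVneq (f s) 0; first by rewrite scale0r mem0v.
by apply: memvZ; apply: memv_span; apply: map_f; rewrite mem_enum; apply: h.
Qed.

Lemma dim_coord_space X : \dim (coord_space X) = #|X|.
Proof.
apply/esym/lead_count => s; split=> [sX|[h /memv_coord_space hX [/hX]]] //.
exists (e_ s).
  by apply/memv_coord_space => t; rewrite ffunE; have [->|] := eqVneq t s;
    rewrite ?eqxx.
split=> [|t]; rewrite ffunE ?eqxx ?oner_eq0 //.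
by case: (eqVneq t s) => //; rewrite eqxx.
Qed.

Section Corner.

Variables (N : {set {set 'I_n}}) (g : 'M[K]_n) (j k : nat).
Hypotheses (stN : stable_family N) (kn : (k <= n)%N).
Hypothesis unit_corner : corner_mx k g \in unitmx.

Let P : 'M[K]_n := pid_mx k.
Let M := P *m g.
Let Nj := [set s in N | #|s| == j].
Let Njk := [set s in N | (#|s| == j) && (max_index s <= k)%N].

(** The images of the first k basis vectors under M form a basis of the space
    of the first k coordinates, as the corner of g is invertible. *)
Lemma corner_lform (m : 'I_n) : exists c : 'I_n -> K,
  lform M m = \sum_(i < n | (i < k)%N) c i *: lform M i.
Proof.
pose Q := invmx (corner_mx k g) *m M.
have PP : P *m P = P by rewrite /P pid_mx_id.
have PC : P *m corner_mx k g = M *m P.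
  by rewrite /corner_mx mulmxDr !mulmxA PP mulmxBr mulmx1 PP subrr addr0.
have ME : M = M *m (P *m Q).
  rewrite mulmxA -PC /Q mulmxA mulmxK // /M mulmxA.
  by rewrite PP.
exists (fun i => Q i m); rewrite {1}ME lform_mul [RHS]big_mkcond.
apply: eq_bigr => i _; rewrite pid_mulE; case: ifP => // _.
by rewrite scale0r.
Qed.

Lemma corner_act t : (max_index t <= k)%N ->
  ext_act M (e_ t) = ext_act (corner_mx k g) (e_ t).
Proof.
move=> /max_index_leP tk; rewrite !ext_act_basis; apply: eq_bigr => i /tk ik.
apply: eq_bigr => l _; congr (_ *: _).
rewrite [RHS]mxE mul_pidE ik -[LHS]addr0; congr (_ + _).
by rewrite !mxE val_eqE; case: eqP => [->|_]; rewrite ?ik /= subrr.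
Qed.

(** Rewrite a factor e_m of e_s, with m the largest element of s and m beyond
    the first k, as a combination of images of e_i with i among the first k:
    each e_i times the rest vanishes or is, up to sign, the monomial with m
    replaced by i < m, still in N by stability. After finitely many steps only
    monomials in the first k variables remain, on which M acts as the
    invertible corner matrix. *)
Lemma ext_act_span (L := linfun (ext_act M))
    (B := linfun (ext_act (corner_mx k g))) :
  (L @: coord_space Nj = B @: coord_space Njk)%VS.
Proof.
have eV s X : s \in X -> e_ s \in coord_space X.
  move=> sX; apply/memv_coord_space => t; rewrite ffunE.
  by have [->|] := eqVneq t s; rewrite ?eqxx.
have LE f : L f = ext_act M f by rewrite lfunE.
have BE f : B f = ext_act (corner_mx k g) f by rewrite lfunE.
apply: subv_anti; apply/andP; split; last first.
  rewrite [X in (_ @: X <= _)%VS]/coord_space limg_span;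
    apply/span_subvP => _ /mapP[_ /mapP[t tN ->] ->].
  move: tN; rewrite mem_enum inE => /and3P[tN tj tk].
  by rewrite BE -corner_act // -LE; apply: memv_img; apply: eV; rewrite inE tN.
rewrite [X in (_ @: X <= _)%VS]/coord_space limg_span;
  apply/span_subvP => _ /mapP[_ /mapP[s sN ->] ->].
move: sN; rewrite mem_enum LE.
(* Induction on the number of elements of s beyond the first k. *)
move: {2}_.+1 (ltnSn #|[set i in s | k <= i]%N|) => d.
elim: d s => // d IHd s hd sNj; have := sNj; rewrite inE => /andP[sN sj].
have [sk|ks] := leqP (max_index s) k.
  by rewrite corner_act // -BE; apply: memv_img; apply: eV; rewrite inE sN sj.
have [|m sm em] := @max_index_attained _ s.
  by apply: contraTneq ks => ->; rewrite -leqNgt; apply: leq_trans (leq0n _);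
    apply/max_index_leP => i; rewrite inE.
have km : (k <= m)%N by rewrite -ltnS -em.
have smax i : i \in s -> (i <= m)%N by move=> /ltn_max_index; rewrite em.
rewrite (ext_basis_D1 K sm) ext_actZ ext_act_var; apply: memvZ.
have [c ->] := corner_lform m.
rewrite mulr_suml; apply: memv_suml => i ik; rewrite -scalerAl; apply: memvZ.
rewrite -ext_act_var ext_mulE disjoints1; case: ifP => is_; last first.
  by rewrite ext_act0 mem0v.
rewrite ext_actZ; apply: memvZ.
have im : (i < m)%N by apply: leq_trans ik km.
have {}is_ : i \notin s.
  by move: is_; rewrite !inE neq_ltn im.
apply: IHd.
  rewrite ltnS in hd; apply: leq_trans hd; apply: proper_card; apply/properP.
  split.
    apply/subsetP => l; rewrite !inE => /andP[/orP[/eqP->|/andP[_ ->]] //].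
    by rewrite leqNgt ik.
  have /negPf mi : m != i by rewrite neq_ltn im orbT.
  by exists m; rewrite !inE ?sm // eqxx mi.
by rewrite inE card_swap // sj andbT; apply: stN.
Qed.

Lemma dim_corner :
  \dim (linfun (ext_act M) @: coord_space Nj) = segment_count N j k.
Proof.
rewrite ext_act_span limg_dim_eq ?dim_coord_space //.
apply/eqP; rewrite -subv0; apply/subvP => f /memv_capP[_].
rewrite memv_ker lfunE /= memv0 => /eqP f0.
by rewrite -[f](ext_actK unit_corner) f0 ext_act0.
Qed.

End Corner.

(** By [revlex_max_index] a monomial in the first k variables is initial for
    an element of g J if and only if it is initial for the projection of that
    element, so the initial monomials of degree j in the first k variables are
    counted by the dimension of the projection of the degree j part of g J,
    computed in [dim_corner]. *)
Lemma gin_segment_count D De g : g \in unitmx ->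
  (forall k, (k <= n)%N -> corner_mx k g \in unitmx) ->
  (forall s t, s \in D -> t \subset s -> t \in D) ->
  stable_family (~: D) ->
  (forall s, s \notin De <-> initial_set (ext_image g (ext_SR_ideal K D)) s) ->
  forall j k, segment_count (~: D) j k = segment_count (~: De) j k.
Proof.
move=> gu cu downD stD DeP j k0.
have red N : segment_count N j k0 = segment_count N j (minn k0 n).
  by apply: eq_card => s; rewrite !inE leq_min max_index_le_n andbT.
rewrite !red; move: (geq_minr k0 n); move: (minn k0 n) => k kn {red k0}.
rewrite -(dim_corner j stD kn (cu k kn)); apply/esym/lead_count => s.
rewrite !inE; split=> [/and3P[/DeP[_ [f fJ ->] [fs flt]] /eqP sj sk]|].
  pose fj := ext_part j f; pose h := ext_act (pid_mx k *m g) fj.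
  have hE t : h t =
      if (max_index t <= k)%N then if #|t| == j then ext_act g f t else 0
      else 0.
    rewrite /h -ext_act_comp ext_act_pid; case: ifP => // _.
    case: eqP => [tj|/eqP tj]; first by rewrite [RHS]ext_act_part tj.
    apply/eqP; apply: contraTT tj => tj; rewrite negbK.
    move: tj; rewrite ext_actE sum_ffunE => /sum_neq0[r].
    rewrite -ext_act_basis ffunE mulf_eq0 negb_or => /andP[].
    rewrite ffunE; case: ifP => [/eqP <- _ /ext_act_homog -> //|_].
    by rewrite eqxx.
  exists h.
    have -> : h = linfun (ext_act (pid_mx k *m g)) fj by rewrite lfunE.
    apply: memv_img; apply/memv_coord_space => t; rewrite ffunE.
    case: ifP => [tj ft|_]; last by rewrite eqxx.
    by rewrite !inE tj andbT; apply: (ext_SR_idealE f downD).1.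
  split=> [|t]; first by rewrite hE sk sj eqxx.
  by rewrite hE; case: ifP => [_|_]; [case: ifP => _|]; rewrite ?eqxx //;
    apply: flt.
case=> _ /memv_imgP[f fV ->]; rewrite lfunE /= -ext_act_comp => -[].
rewrite ext_act_pid; case: ifP => [sk fs|_]; last by rewrite eqxx.
move/memv_coord_space: fV => fV hlt.
have homj t : ext_act g f t != 0 -> #|t| = j.
  rewrite ext_actE sum_ffunE => /sum_neq0[r].
  rewrite -ext_act_basis ffunE mulf_eq0 negb_or => /andP[/fV];
    rewrite inE => /andP[_ /eqP <-].
  exact: ext_act_homog.
rewrite (homj s fs) eqxx !andbT; apply/DeP; exists (ext_act g f).
  exists f => //; apply/ext_SR_idealE => // t /fV.
  by rewrite !inE => /andP[].
split=> // t ft ts; have [tk|kt] := leqP (max_index t) k.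
  by apply: hlt => //; rewrite ext_act_pid tk.
by apply: revlex_max_index sk kt; rewrite !homj.
Qed.

(** The exterior form of the theorem of Galligo: shearing g in the direction
    of the elementary matrix stays in U for almost all c, so the exponent set
    obtained in [initial_shear] belongs to the same generic initial ideal. *)
Lemma gin_stable D De U : infinite_field K -> zariski_open_GL U ->
  (exists g : 'M[K]_n, U g) ->
  (forall g, U g -> forall s,
     s \notin De <-> initial_set (ext_image g (ext_SR_ideal K D)) s) ->
  stable_family (~: De).
Proof.
move=> infK oU [g Ug] H s m i; rewrite !inE => /(H g Ug)[h hJ hs] ms _ im is_.
have [q q0 qU] := zariski_open_line (delta_mx i m *m g) oU Ug.
have [|c] := @poly_nonroot _ (q * 'X) infK.
  by rewrite mulf_neq0 ?polyX_eq0 //; apply: contraNneq q0 => ->;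
    rewrite horner0.
rewrite hornerM hornerX mulf_eq0 negb_or => /andP[/qU Uc c0].
apply/(H _ Uc).
exists (ext_act (1%:M + c *: delta_mx i m) h); last exact: initial_shear.
case: hJ => f fJ ->; exists f => //.
by rewrite ext_act_comp mulmxDl mul1mx scalemxAl.
Qed.

Lemma stable_complexP D : (forall s t, s \in D -> t \subset s -> t \in D) ->
  stable_complex K D -> stable_family (~: D).
Proof.
move=> downD [_ st] s m i; rewrite inE => sD ms mmax im is_.
have IE t : SR_ideal K D (xprod K t) <-> t \notin D.
  by rewrite SR_idealE // sqf_ideal_xprod inE.
rewrite inE; apply/IE.
have := st s m i ((IE s).2 sD) ms mmax im is_.
by rewrite /xprod big_setU1 //= !inE negb_and is_ orbT.
Qed.

End SegmentCounts.

Theorem proposition1p6 (K : fieldType) (n : nat) (D De : {set {set 'I_n}}) :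
  infinite_field K ->
  simplicial_complex D ->
  stable_complex K D ->
  is_exterior_shifting K D De ->
  forall i j : nat,
    graded_betti (SR_ideal K D) i j = graded_betti (SR_ideal K De) i j.
Proof.
move=> infK [downD _] /(stable_complexP downD) stD [[downDe _] [U [oU Une HU]]]
  i j.
have upC (C : {set {set 'I_n}}) :
    (forall s t : {set 'I_n}, s \in C -> t \subset s -> t \in C) ->
      upclosed (~: C).
  by move=> h s t; rewrite !inE => sC st; apply: contra sC => /h; apply.
have DeP g : U g -> forall s,
    s \notin De <-> initial_set (ext_image g (ext_SR_ideal K D)) s.
  by move=> Ug; apply: gin_initial_set => //; [apply: oU.1|apply: HU].
have stDe := gin_stable infK oU Une DeP.
have [g Ug gcorner] := zariski_open_generic infK oU Une.
rewrite !graded_betti_stable //; apply: ek_count_eq => //; try exact: upC.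
exact: gin_segment_count (oU.1 _ Ug) gcorner downD stD (DeP _ Ug).
Qed.
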